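(* Let $\mathbb{O}$ be an octonion algebra over a field $k$ of characteristic not two or three, and let $\mu_{\mathbb{O}},\psi_{\mathbb{O}},Q_{\mathbb{O}}$ be the covariants of the special orthogonal representation $\rho : \mathfrak{h} \rightarrow \mathfrak{so}(\mathbb{O},B)$ of the quadratic Lie algebra $(\mathfrak{h},B_{\mathfrak{h}})$ described in the context. Then: a) $\psi_{\mathbb{O}}(v_1,v_2,v_3)=-\frac{1}{2}(v_1,v_2,v_3)+\phi(v_1,v_2,v_3)$ and $\psi_{\mathbb{O}}(v_1,v_2,1)=-v_1\times v_2$ for all $v_1,v_2,v_3\in \mathrm{Im}(\mathbb{O})$; b) $Q_{\mathbb{O}}(v_1,v_2,v_3,v_4)=\frac{2}{3}Q_{\mathrm{Im}}(v_1,v_2,v_3,v_4)$ and $Q_{\mathbb{O}}(v_1,v_2,v_3,1)=-4\phi(v_1,v_2,v_3)$ for all $v_1,v_2,v_3,v_4\in \mathrm{Im}(\mathbb{O})$; c) with respect to the basis $\{e_1,\dots,e_8\}$ of $\mathbb{O}$ described in the context, \begin{align*} \eta^{-1}(Q_{\mathbb{O}})&=\frac{4}{q(e_2)q(e_3)}e_{1234}-\frac{4}{q(e_2)q(e_3)q(e_5)}e_{1278}+\frac{4}{q(e_2)q(e_3)q(e_5)}e_{1368}-\frac{4}{q(e_2)q(e_3)q(e_5)}e_{1467}\\ &\quad+\frac{4}{q(e_2)q(e_5)}e_{1256}+\frac{4}{q(e_3)q(e_5)}e_{1357}+\frac{4}{q(e_2)q(e_3)q(e_5)}e_{1458}+\frac{4}{q(e_2)q(e_3)q(e_5)}e_{2358}\\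 &\quad-\frac{4}{q(e_2)q(e_3)q(e_5)}e_{2367}-\frac{4}{q(e_2)q(e_3)q(e_5)}e_{2457}-\frac{4}{q(e_2)^2q(e_3)q(e_5)}e_{2468}+\frac{4}{q(e_2)q(e_3)q(e_5)}e_{3456}\\ &\quad-\frac{4}{q(e_2)q(e_3)^2q(e_5)}e_{3478}-\frac{4}{q(e_2)q(e_3)q(e_5)^2}e_{5678}. \end{align*}
   Context: $\mathbb{O}$ is an octonion (Cayley) algebra over $k$, i.e. an $8$-dimensional unital composition algebra, with norm $q$ and conjugation $u\mapsto\bar u$, $q(u)=u\bar u$; $\mathrm{Im}(\mathbb{O})=\{u\in\mathbb{O}: \bar u=-u\}$; $\mathbb{O}=k\oplus\mathrm{Im}(\mathbb{O})$; $B$ is the symmetric bilinear form with $B(u,u)=q(u)$. The associator is $(u,v,w)=(uv)w-u(vw)$, the cross-product is $u\times v=\frac12(\bar v u-\bar u v)$ (so $u\times v=\frac12(uv-vu)$ on $\mathrm{Im}(\mathbb{O})$), and $\phi(u,v,w)=B(u,v\times w)$ for $u,v,w\in\mathrm{Im}(\mathbb{O})$. Let $e_2,e_3,e_5\in\mathrm{Im}(\mathbb{O})$ be such that $\{1,e_2,e_3,e_2e_3,e_5,e_2e_5,e_3e_5,(e_2e_3)e_5\}$ is an orthogonal basis of $\mathbb{O}$ consisting of anisotropic vectors, and set $e_1=1$, $e_4=e_2e_3$, $e_6=e_2e_5$, $e_7=e_3e_5$, $e_8=(e_2e_3)e_5$. Write $e_{i_1\ldots i_n}=e_{i_1}\wedge\dots\wedge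 e_{i_n}$. The isomorphism $\eta:\Lambda^i(\mathbb{O})\to\Lambda^i(\mathbb{O})^*$ is given by $\eta(v_1\wedge\dots\wedge v_i)(w_1\wedge\dots\wedge w_i)=\det(B(v_a,w_b))$. Left multiplication $\rho(u)(x)=ux$ ($u\in\mathrm{Im}(\mathbb{O})$, $x\in\mathbb{O}$) satisfies $\rho(u)^2=-q(u)\mathrm{Id}$, hence extends to an algebra morphism $\rho:C(\mathrm{Im}(\mathbb{O}),-q)\to\mathrm{End}(\mathbb{O})$ from the Clifford algebra (in which $u^2=-q(u)$). Let $\mathfrak{h}=C^2(\mathrm{Im}(\mathbb{O}),-q)$ be the span of the elements $uv-vu$ with $u,v\in\mathrm{Im}(\mathbb{O})$, a Lie algebra under the commutator (of type $\mathfrak{so}(7)$), with $B_{\mathfrak{h}}(x,y)=-\frac38\mathrm{Tr}(\rho(x)\rho(y))$, acting on $\mathbb{O}$ by $\rho$. Let $\mathfrak{g}=\{x\in \mathfrak{h}: \rho(x)(1)=0\}$, a Lie algebra of type $G_2$ with $B_{\mathfrak{g}}(x,y)=-\frac13\mathrm{Tr}(\rho(x)\rho(y))$, acting on $\mathrm{Im}(\mathbb{O})$ by $\rho$. For an orthogonal representation $\rho:\mathfrak{l}\to\mathfrak{so}(V,(\ ,\ ))$ of a quadratic Lie algebra $(\mathfrak{l},B_{\mathfrak{l}})$, the moment map $\mu:V\times V\to\mathfrak{l}$ is determined by $B_{\mathfrak{l}}(x,\mu(v,w))=(\rho(x)(v),w)$ for all $x\in\mathfrak{l}$, $v,w\in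 V$; write $\mu(u,v)(w)$ for $\rho(\mu(u,v))(w)$. The representation is special orthogonal if $\mu(u,v)(w)+\mu(u,w)(v)=(u,v)w+(u,w)v-2(v,w)u$ for all $u,v,w \in V$. Its covariants are then $\mu$ and the alternating maps \begin{align*} \psi(v_1,v_2,v_3)&=\mu(v_1,v_2)(v_3)+\mu(v_3,v_1)(v_2)+\mu(v_2,v_3)(v_1),\\ Q(v_1,v_2,v_3,v_4)&=(v_1,\psi(v_2,v_3,v_4))-(v_4,\psi(v_1,v_2,v_3))+(v_3,\psi(v_4,v_1,v_2))-(v_2,\psi(v_3,v_4,v_1)). \end{align*} Both $(\mathfrak{h},B_{\mathfrak{h}})$ acting on $(\mathbb{O},B)$ and $(\mathfrak{g},B_{\mathfrak{g}})$ acting on $(\mathrm{Im}(\mathbb{O}),B)$ are special orthogonal; their covariants are denoted $\mu_{\mathbb{O}},\psi_{\mathbb{O}},Q_{\mathbb{O}}$ and $\mu_{\mathrm{Im}},\psi_{\mathrm{Im}},Q_{\mathrm{Im}}$ respectively. *)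

(* Defs.v *)
From HB Require Import structures.
From mathcomp Require Import all_boot all_order all_algebra all_field.
From mathcomp Require Import sesquilinear.

Set Implicit Arguments.
Unset Strict Implicit.
Unset Printing Implicit Defensive.

Import GRing.Theory.
Local Open Scope ring_scope.

Definition polar (k : fieldType) (V : lmodType k) (q : V -> k) (u v : V) : k :=
  q (u + v) - q u - q v.

Definition quadratic_form (k : fieldType) (V : lmodType k) (q : V -> k) : Prop :=
  (forall a u, q (a *: u) = a ^+ 2 * q u) /\ bilinear_for *%R *%R (polar q).

Record compAlgebra (k : fieldType) := CompAlgebra {
  ca_space :> vectType k;
  omul : {bilinear ca_space -> ca_space -> ca_space};
  o1 : ca_space;
  onorm : ca_space -> k;
  omul1l : left_id o1 omul;
  omul1r : right_id o1 omul;
  onorm_quadratic : quadratic_form onorm;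
  onorm_nondegenerate : forall u, (forall v, polar onorm u v = 0) -> u = 0;
  onormM : {morph onorm : u v / omul u v >-> u * v}
}.

Arguments o1 {k c}.
Arguments omul {k c}.
Arguments onorm {k c}.

Record octonionAlgebra (k : fieldType) := OctonionAlgebra {
  oct_comp :> compAlgebra k;
  oct_dim : \dim {: oct_comp} = 8
}.

Section CompositionAlgebra.

Variables (k : fieldType) (O : compAlgebra k).
Implicit Types u v w : O.

Local Notation "u *o v" := (omul u v) (at level 40, left associativity).

(* Normalised so that [oform u u = onorm u] when 2 is invertible. *)
Definition oform u v : k := 2%:R^-1 * polar onorm u v.

Definition oconj u : O := (2%:R * oform u o1) *: o1 - u.

Fact oconj_is_linear : linear oconj.
Proof.
have [_ [lin1 _]] := onorm_quadratic O.
move=> a u v; rewrite /oconj /oform lin1 scalerBr scalerA opprD addrACA.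
rewrite -scalerDl; move: (polar _ u _) (polar _ v _) => x y.
by rewrite !mulrDr [2%:R^-1 * (a * _)]mulrCA [2%:R * (a * _)]mulrCA.
Qed.
HB.instance Definition _ :=
  GRing.isSemilinear.Build k O O _ oconj (GRing.semilinear_linear oconj_is_linear).

Definition imO : {vspace O} := lker (\1%VF + linfun oconj)%R.

Lemma mem_imO u : (u \in imO) = (oconj u == - u).
Proof. by rewrite memv_ker add_lfunE id_lfunE lfunE /= addrC addr_eq0. Qed.

Definition associator u v w : O := (u *o v) *o w - u *o (v *o w).

Definition cross u v : O := 2%:R^-1 *: (oconj v *o u - oconj u *o v).

Definition phi u v w : k := oform u (cross v w).

(* The value of the form of the Clifford algebra C(Im(O), -q): there u^2 = -q(u). *)
Definition opp_norm_im (u : subvs_of imO) : k := - onorm (vsval u).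

End CompositionAlgebra.

Definition clifford_map (k : fieldType) (V : lmodType k) (Q : V -> k)
    (A : algType k) (j : {linear V -> A}) : Prop :=
  forall v, j v ^+ 2 = (Q v)%:A.

(* Universal property of C(V, Q). For finite-dimensional [V], the algebra is
   finite-dimensional, so nothing is lost by later taking [C] in [falgType k]. *)
Definition clifford_algebra (k : fieldType) (V : lmodType k) (Q : V -> k)
    (C : algType k) (iota : {linear V -> C}) : Prop :=
  clifford_map Q iota /\
  forall (A : algType k) (j : {linear V -> A}), clifford_map Q j ->
    exists2 f : {lrmorphism C -> A}, (forall v, f (iota v) = j v) &
      forall g : {lrmorphism C -> A}, (forall v, g (iota v) = j v) -> g =1 f.

(* C^2: a spanning family indexed by a basis of [V]; [mem_clifford2] and
   [clifford2_min] say that it is the span of all the [uv - vu]. *)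
Definition clifford2 (k : fieldType) (V : vectType k) (C : falgType k)
    (iota : {linear V -> C}) : {vspace C} :=
  <<[seq iota u * iota v - iota v * iota u
       | u <- vbasis {:V}, v <- vbasis {:V}]>>%VS.

Lemma mem_clifford2 (k : fieldType) (V : vectType k) (C : falgType k)
    (iota : {linear V -> C}) (u v : V) :
  iota u * iota v - iota v * iota u \in clifford2 iota.
Proof.
pose br (x y : C) := x * y - y * x.
have extend y : (forall e, e \in vbasis {:V} -> br (iota e) y \in clifford2 iota) ->
    forall x, br (iota x) y \in clifford2 iota.
  have brE x : br (iota x) y = (amulr y - amull y)%VF (iota x).
    by rewrite !lfunE /= opp_lfunE !lfunE.
  move=> sub x; rewrite brE (coord_vbasis (memvf x)) !linear_sum.
  apply: memv_suml => i _; rewrite !linearZ memvZ //= -brE.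
  by apply: sub; rewrite mem_nth ?size_tuple.
apply: (extend) => e eP; rewrite -memvN opprB; apply: extend => e' e'P.
by rewrite memv_span //; apply/allpairsP; exists (e', e).
Qed.

Lemma clifford2_min (k : fieldType) (V : vectType k) (C : falgType k)
    (iota : {linear V -> C}) (U : {vspace C}) :
  (forall u v, iota u * iota v - iota v * iota u \in U) ->
  (clifford2 iota <= U)%VS.
Proof. by move=> sU; apply/span_subvP => _ /allpairsP[[u v] [_ _ ->]]. Qed.

Definition lfun_trace (k : fieldType) (V : vectType k) (f : 'End(V)) : k :=
  \tr (passmx.mxof (vbasis {:V}) (vbasis {:V}) f).

Definition algebra_representation (k : fieldType) (C : algType k)
    (V : vectType k) (rho : {linear C -> 'End(V)}) : Prop :=
  rho 1 = \1%VF /\ forall x y, rho (x * y) = (rho x \o rho y)%VF.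

(* The Lie algebra is a subspace [l] of the ambient [L], acting on the subspace
   [W] of [V] through [act]; [mu] is only constrained on [W]. *)
Definition moment_map (k : fieldType) (L : lmodType k) (V : vectType k)
    (l : {pred L}) (W : {pred V}) (Bl : L -> L -> k)
    (act : L -> 'End(V)) (form : V -> V -> k) (mu : V -> V -> L) : Prop :=
  forall v w, v \in W -> w \in W ->
    mu v w \in l /\ forall x, x \in l -> Bl x (mu v w) = form (act x v) w.

Definition cov_psi (k : fieldType) (L : lmodType k) (V : vectType k)
    (act : L -> 'End(V)) (mu : V -> V -> L) (v1 v2 v3 : V) : V :=
  act (mu v1 v2) v3 + act (mu v3 v1) v2 + act (mu v2 v3) v1.

Definition cov_Q (k : fieldType) (L : lmodType k) (V : vectType k)
    (act : L -> 'End(V)) (form : V -> V -> k) (mu : V -> V -> L) (v1 v2 v3 v4 : V) : k :=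
  let psi := cov_psi act mu in
  form v1 (psi v2 v3 v4) - form v4 (psi v1 v2 v3)
  + form v3 (psi v4 v1 v2) - form v2 (psi v3 v4 v1).

Section LieAlgebras.

Variables (k : fieldType) (O : compAlgebra k) (C : falgType k).
Variables (iota : {linear subvs_of (imO O) -> C}) (rho : {linear C -> 'End(O)}).

Definition left_mul_extension : Prop :=
  algebra_representation rho /\
  forall u x, rho (iota u) x = omul (vsval u) x.

Definition lie_h : {vspace C} := clifford2 iota.

Definition form_h (x y : C) : k :=
  - (3%:R / 8%:R) * lfun_trace (rho x \o rho y)%VF.

Definition lie_g : {pred C} := [pred x | (x \in lie_h) && (rho x o1 == 0)].

Definition form_g (x y : C) : k :=
  - (1 / 3%:R) * lfun_trace (rho x \o rho y)%VF.

Definition moment_map_O (mu : O -> O -> C) : Prop :=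
  moment_map lie_h {:O}%VS form_h rho (@oform k O) mu.

Definition moment_map_Im (mu : O -> O -> C) : Prop :=
  moment_map lie_g (imO O) form_g rho (@oform k O) mu.

End LieAlgebras.

Definition alternating_multilinear (k : fieldType) (n : nat) (V M : lmodType k)
    (f : n.-tuple V -> M) : Prop :=
  (forall (i : 'I_n) (a : k) (u v w : n.-tuple V),
     tnth w i = a *: tnth u i + tnth v i ->
     (forall j, j != i -> tnth u j = tnth w j /\ tnth v j = tnth w j) ->
     f w = a *: f u + f v) /\
  (forall (w : n.-tuple V) (i j : 'I_n),
     i != j -> tnth w i = tnth w j -> f w = 0).

(* Universal property of Lambda^n(V), with [wedge] sending (v_1, ..., v_n) to
   v_1 /\ ... /\ v_n. *)
Definition exterior_power (k : fieldType) (n : nat) (V L : lmodType k)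
    (wedge : n.-tuple V -> L) : Prop :=
  alternating_multilinear wedge /\
  forall (M : lmodType k) (f : n.-tuple V -> M), alternating_multilinear f ->
    exists2 g : {linear L -> M}, (forall v, g (wedge v) = f v) &
      forall h : {linear L -> M}, (forall v, h (wedge v) = f v) -> h =1 g.

Definition exterior_duality (k : fieldType) (n : nat) (V : lmodType k)
    (L : vectType k) (form : V -> V -> k) (wedge : n.-tuple V -> L)
    (eta : 'Hom(L, 'Hom(L, k^o))) : Prop :=
  forall v w : n.-tuple V,
    eta (wedge v) (wedge w) = \det (\matrix_(a, b) form (tnth v a) (tnth w b)).

(* A 4-form seen as a linear form on Lambda^4(V). *)
Definition linear_form_of (k : fieldType) (V : lmodType k) (L : vectType k)
    (wedge : 4.-tuple V -> L) (F : V -> V -> V -> V -> k)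
    (Flin : 'Hom(L, k^o)) : Prop :=
  forall v1 v2 v3 v4, Flin (wedge [tuple v1; v2; v3; v4]) = F v1 v2 v3 v4.

Definition oct_basis (k : fieldType) (O : compAlgebra k) (e2 e3 e5 : O) : seq O :=
  [:: o1; e2; e3; omul e2 e3; e5; omul e2 e5; omul e3 e5; omul (omul e2 e3) e5].

Definition orthogonal_anisotropic_basis (k : fieldType) (O : compAlgebra k)
    (s : seq O) : Prop :=
  [/\ basis_of {:O}%VS s, pairwise (fun u v => oform u v == 0) s
    & all (fun u => onorm u != 0) s].

(* e_i ^ e_j ^ e_l ^ e_m, with indices starting at 1. *)
Definition wedge_basis (k : fieldType) (O : compAlgebra k) (L : vectType k)
    (wedge : 4.-tuple O -> L) (e2 e3 e5 : O) (i j l m : nat) : L :=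
  let e n := (oct_basis e2 e3 e5)`_(n.-1) in wedge [tuple e i; e j; e l; e m].

(* Main.v *)
From HB Require Import structures.
Require Import Defs.
From mathcomp Require Import all_boot all_order all_algebra all_field.
From mathcomp Require Import all_fingroup sesquilinear ring.
Set Implicit Arguments.
Unset Strict Implicit.
Unset Printing Implicit Defensive.
Import GRing.Theory.
Local Open Scope ring_scope.

(** The covariants can be computed because both moment maps have closed forms.
    Write E(v,w) x = B(v,x) w - B(w,x) v for the infinitesimal rotation in the
    plane of v and w ([rank2]), L_a and R_a for left and right multiplication.
    A skew x satisfies Tr(x E(v,w)) = - 2 B(x v, w) ([tr_rank2]), so a moment
    map defined by a multiple of the trace form is a multiple of the orthogonal
    projection of E(v,w) onto the Lie algebra.

    For h, with a, b, c imaginary, the only skew endomorphism that is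
    trace-orthogonal to all the [L_a, L_b] and all the L_c is 0 ([skew_eq0]),
    and the L_c are themselves orthogonal to h ([tr_Lmul_commL]).  Removing
    from 4/3 E(v,w) its component along the L_c leaves
      mu(v,w) = 4/3 E(v,w) - 1/3 L_c,  c the imaginary part of w times conj v
    ([rho_muO]).  For g one removes the components along the L_c and the R_c,
    with the outcome mu(v,w) = 3/2 E(v,w) - 1/4 (L_d - R_d), d = v x w
    ([rho_muIm]); here the moment map of h supplies the elements that correct
    a commutator [L_a, L_b] into an element of g.

    In psi the terms coming from E cancel, and what is left is a cyclic sum of
    products.  The cyclic sum of (u x v) x w is 3/2 times the associator
    ([jacobi_cross]), which gives a) and shows that both quadrilinear
    covariants are multiples of the same alternating sum built from the
    associator, whence b).

    For c), Q(v1,v2,v3,v4) = 4 B(v1 conj v4, v2 conj v3) when the arguments are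
    pairwise orthogonal ([QO_orthogonal]).  The eight basis vectors arise from
    1 by three Cayley-Dickson doublings, so they are indexed by F_2^3 and the
    product of two of them is a multiple of the one indexed by the sum
    ([cdmon_mul]).  Hence Q vanishes on four distinct basis vectors unless
    their indices add up to 0, that is, form one of the 14 affine planes of
    F_2^3; on these, [cdsign] and [cdcoef] give the value.  Finally,
    n! x = sum_t eta(x)(e_t) / q(e_t) e_t over all words t of length n
    ([eta_expand]): this inverts eta ([eta_invE]), and the sum over words folds
    into a sum over increasing words ([big_tuple_sorted]). *)

(** * Alternating maps and exterior powers *)

Section Alternating.

Variables (k : fieldType) (V M : lmodType k).

Lemma linear_comb (I : finType) (g : V -> M) (c : I -> k) (x : I -> V) :
  linear g -> g (\sum_j c j *: x j) = \sum_j c j *: g (x j).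
Proof.
move=> lg; pose h := HB.pack_for {linear V -> M} g
  (GRing.isSemilinear.Build k V M *:%R g (GRing.semilinear_linear lg)).
rewrite -[g]/(h : V -> M) linear_sum.
by apply: eq_bigr => j _; rewrite linearZ.
Qed.

(** Fixing the first argument keeps this half of [alternating_multilinear] in a
    form suited to induction on [n]. *)
Definition multilinear n (f : n.-tuple V -> M) :=
  forall (i : 'I_n) (a : k) (u v w : n.-tuple V),
    tnth w i = a *: tnth u i + tnth v i ->
    (forall j, j != i -> tnth u j = tnth w j /\ tnth v j = tnth w j) ->
    f w = a *: f u + f v.

Lemma multilinear_cons n (f : n.+1.-tuple V -> M) x :
  multilinear f -> multilinear (fun t : n.-tuple V => f [tuple of x :: t]).
Proof.
move=> mf i a u v w wE uvE; apply: (mf (lift ord0 i)); rewrite ?tnthS //.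
move=> j; case: (unliftP ord0 j) => [l ->|-> _]; last by rewrite !tnth0.
by rewrite (inj_eq lift_inj) !tnthS; apply: uvE.
Qed.

Lemma multilinear_head n (f : n.+1.-tuple V -> M) (t : n.-tuple V) :
  multilinear f -> linear (fun x => f [tuple of x :: t]).
Proof.
move=> mf a x y; apply: (mf ord0); rewrite ?tnth0 //.
by move=> j; case: (unliftP ord0 j) => [l ->|-> /eqP[]//]; rewrite !tnthS.
Qed.

Lemma big_tuple_recl n (T : finType) (F : n.+1.-tuple T -> M) :
  \sum_t F t = \sum_x \sum_(t : n.-tuple T) F [tuple of x :: t].
Proof.
rewrite pair_big /=.
apply: (reindex (fun p : T * n.-tuple T => [tuple of p.1 :: p.2])).
exists (fun t : n.+1.-tuple T => (thead t, [tuple of behead t]))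
  => [[x t] _|t _] /=.
  by congr (_, _); apply: val_inj.
by rewrite -tuple_eta.
Qed.

Lemma multilinear_expand m n (c : V -> 'I_m -> k) (e : 'I_m -> V)
    (f : n.-tuple V -> M) (v : n.-tuple V) :
  (forall x, x = \sum_j c x j *: e j) -> multilinear f ->
  f v = \sum_(t : n.-tuple 'I_m)
    (\prod_(i < n) c (tnth v i) (tnth t i)) *: f [tuple of map e t].
Proof.
move=> cE; elim: n f v => [|n IHn] f v mf.
  rewrite (big_pred1 [tuple]) => [|t].
    2: by apply/esym/eqP/val_inj; case: t => -[].
  by rewrite big_ord0 scale1r; congr f; apply: val_inj; case: v => -[].
have lin t := multilinear_head t mf.
case/tupleP: v => x v.
rewrite (IHn (fun t => f [tuple of x :: t])); last exact: multilinear_cons.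
rewrite big_tuple_recl exchange_big; apply: eq_bigr => t _.
have -> : f [tuple of x :: [tuple of map e t]] =
    \sum_j c x j *: f [tuple of e j :: [tuple of map e t]].
  by rewrite -(linear_comb _ _ (lin [tuple of map e t])) -cE.
rewrite scaler_sumr; apply: eq_bigr => j _.
rewrite scalerA mulrC big_ord_recl !tnth0; congr (_ * _ *: _).
  by apply: eq_bigr => i _; rewrite !tnthS.
by congr f; apply: val_inj.
Qed.

Definition tuple_perm n T (v : n.-tuple T) (s : 'S_n) : n.-tuple T :=
  [tuple tnth v (s i) | i < n].

Variables (n : nat) (f : n.-tuple V -> M).
Hypothesis altf : alternating_multilinear f.

(** Polarisation: as a function of its entries i and j, f is biadditive and
    vanishes on the diagonal. *)
Lemma alternating_swap (v : n.-tuple V) i j : i != j ->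
  f (tuple_perm v (tperm i j)) = - f v.
Proof.
have [mf f0] := altf; move=> ij.
pose h x y :=
  f [tuple if l == i then x else if l == j then y else tnth v l | l < n].
have ji : j == i = false by rewrite eq_sym (negPf ij).
have h0 x : h x x = 0.
  by apply: (f0 _ i j); rewrite // !tnth_mktuple eqxx ji eqxx.
have hDl x x' y : h (x + x') y = h x y + h x' y.
  rewrite -[h x y]scale1r; apply: (mf i).
    by rewrite !tnth_mktuple eqxx scale1r.
  by move=> l /negPf li; rewrite !tnth_mktuple li.
have hDr x y y' : h x (y + y') = h x y + h x y'.
  rewrite -[h x y]scale1r; apply: (mf j).
    by rewrite !tnth_mktuple eqxx ji scale1r.
  by move=> l /negPf lj; rewrite !tnth_mktuple lj.
have hC x y : h x y = - h y x.
  have /eqP := h0 (x + y); rewrite hDl !hDr !h0 add0r addr0 addr_eq0.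
  by move/eqP.
have -> : tuple_perm v (tperm i j) =
  [tuple if l == i then tnth v j else if l == j then tnth v i else tnth v l
  | l < n].
  apply: eq_from_tnth => l; rewrite !tnth_mktuple.
  by have [->|li] := eqVneq l i; [rewrite tpermL|have [->|lj] := eqVneq l j;
     [rewrite tpermR | rewrite tpermD // eq_sym]].
rewrite -/(h _ _) hC; congr (- f _); apply: eq_from_tnth => l.
rewrite !tnth_mktuple.
by have [->|li] := eqVneq l i; [|have [->|] := eqVneq l j].
Qed.

Lemma alternating_perm (v : n.-tuple V) (s : 'S_n) :
  f (tuple_perm v s) = (-1) ^+ s *: f v.
Proof.
have [ts -> dts] := prod_tpermP s; elim: ts v dts => [|[i j] ts IH] v /=.
  move=> _; rewrite big_nil odd_perm1 scale1r; congr f.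
  by apply: eq_from_tnth => l; rewrite tnth_mktuple perm1.
case/andP => dij /IH{}IH; rewrite big_cons /= odd_mul_tperm.
rewrite -[X in X (+) _]/(i != j) (dij : i != j).
have -> : tuple_perm v (tperm i j * \prod_(t <- ts) tperm t.1 t.2)%g =
   tuple_perm (tuple_perm v (\prod_(t <- ts) tperm t.1 t.2)%g) (tperm i j).
  by apply: eq_from_tnth => l; rewrite !tnth_mktuple permM.
by rewrite alternating_swap // IH signr_addb mulN1r scaleNr.
Qed.

Lemma alternating_uniq m (e : 'I_m -> V) (t : n.-tuple 'I_m) :
  ~~ uniq t -> f [tuple of map e t] = 0.
Proof.
have [_ f0] := altf.
rewrite (sameP (tuple_uniqP t) (injectiveP _)) => /injectivePn[i [j ij eqt]].
by apply: (f0 _ i j ij); rewrite !tnth_map eqt.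
Qed.

Lemma tuple_perm_inj (T : Type) (s : 'S_n) :
  injective (fun t : n.-tuple T => tuple_perm t s).
Proof.
move=> t u /(congr1 (fun v => tnth v)) eqtu; apply: eq_from_tnth => i.
by have := congr1 (@^~ (s^-1%g i)) eqtu; rewrite !tnth_mktuple permKV.
Qed.

Lemma tuple_perm_map m (e : 'I_m -> V) (t : n.-tuple 'I_m) (s : 'S_n) :
  [tuple of map e (tuple_perm t s)] = tuple_perm [tuple of map e t] s.
Proof. by apply: eq_from_tnth => i; rewrite tnth_map !tnth_mktuple tnth_map. Qed.

Variables (m : nat) (b : V -> V -> k) (e : 'I_m -> V) (d : 'I_m -> k).
Hypothesis dual_basis : forall x, x = \sum_j (b x (e j) / d j) *: e j.

(** In the Leibniz formula for the Gram determinant, the sign of each permutation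
    is absorbed by permuting the arguments of f; each of the n! permutations then
    contributes one copy of the expansion of f v in the dual bases. *)
Lemma gram_expand (v : n.-tuple V) :
  \sum_(t : n.-tuple 'I_m)
     ((\prod_i d (tnth t i))^-1 *
        \det (\matrix_(i, j) b (tnth v i) (tnth [tuple of map e t] j)))
       *: f [tuple of map e t] = n`!%:R *: f v.
Proof.
pose c x j := b x (e j) / d j.
pose G (t : n.-tuple 'I_m) :=
  (\prod_i c (tnth v i) (tnth t i)) *: f [tuple of map e t].
transitivity (\sum_(s : 'S_n) \sum_(t : n.-tuple 'I_m) G (tuple_perm t s)).
  rewrite exchange_big; apply: eq_bigr => t _ /=.
  rewrite /determinant mulr_sumr scaler_suml; apply: eq_bigr => s _.
  rewrite /G tuple_perm_map alternating_perm scalerA; congr (_ *: _).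
  rewrite mulrCA mulrC; congr (_ * _).
  under [RHS]eq_bigr do rewrite /c tnth_mktuple.
  have -> : \prod_i d (tnth t i) = \prod_i d (tnth t (s i)).
    exact: (reindex_inj (@perm_inj _ s)).
  rewrite prodf_div mulrC.
  by congr (_ / _); apply: eq_bigr => i _; rewrite mxE tnth_map.
transitivity (\sum_(s : 'S_n) f v); last first.
  by rewrite sumr_const card_Sn scaler_nat.
apply: eq_bigr => s _; have [mf _] := altf.
rewrite [RHS](multilinear_expand _ dual_basis mf).
by apply/esym; apply: reindex_inj; apply: tuple_perm_inj.
Qed.

End Alternating.

(** Sorting maps the words without repetition onto the increasing ones, and each
    of its fibres consists of the n! permutations of a word. *)
Lemma big_tuple_sorted (k : fieldType) (M : lmodType k) m n
    (G : n.-tuple 'I_m -> M) :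
  (forall t : n.-tuple _, ~~ uniq t -> G t = 0) ->
  (forall t u : n.-tuple 'I_m, perm_eq t u -> G t = G u) ->
  \sum_t G t = n`!%:R *: \sum_(t : n.-tuple 'I_m | sorted ltn (map val t)) G t.
Proof.
move=> G0 Gperm; pose le := relpre (val : 'I_m -> nat) leq.
have le_total : total le by move=> x y; apply: leq_total.
have le_trans : transitive le by move=> x y z; apply: leq_trans.
have le_anti : antisymmetric le by move=> x y /anti_leq/val_inj.
have sortedE (t : n.-tuple 'I_m) :
  sorted ltn (map val t) = uniq t && (sort le t == t :> seq _).
  rewrite ltn_sorted_uniq_leq map_inj_uniq; last exact: val_inj.
  congr (_ && _); rewrite sorted_map -/le.
  by apply/idP/eqP => [/sorted_sort->|<-]; rewrite ?sort_sorted.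
rewrite (bigID (fun t : n.-tuple 'I_m => uniq t)) /=.
rewrite [X in _ + X]big1 ?addr0; last exact: G0.
rewrite (partition_big (fun t : n.-tuple 'I_m => [tuple of sort le t])
   (fun t : n.-tuple 'I_m => sorted ltn (map val t))); last first.
  by move=> t ut; rewrite sortedE sort_uniq ut sorted_sort ?sort_sorted ?eqxx.
rewrite scaler_sumr; apply: eq_bigr => t; rewrite sortedE => /andP[ut /eqP st].
have PE (u : n.-tuple 'I_m) :
  uniq u && ([tuple of sort le u] == t) = perm_eq u t.
  rewrite -val_eqE /=; apply/andP/idP => [[uu /eqP <-]|ut'].
    by rewrite perm_sym perm_sort.
  rewrite (perm_uniq ut') ut; split=> //; apply/eqP; rewrite -[RHS]st.
  exact/(perm_sortP le_total le_trans le_anti).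
rewrite (eq_bigl _ _ PE) (eq_bigr (fun=> G t)); last by move=> u /Gperm.
rewrite sumr_const scaler_nat; congr (_ *+ _).
rewrite -[in RHS](size_tuple t) -(size_permutations ut) cardE -(size_map val).
apply/perm_size/uniq_perm.
- by rewrite map_inj_uniq ?enum_uniq //; apply: val_inj.
- exact: permutations_uniq.
move=> s; rewrite mem_permutations; apply/mapP/idP => [[u]|st'].
  by rewrite mem_enum => ut' ->.
have ss : size s == n by rewrite (perm_size st') size_tuple.
by exists (Tuple ss); rewrite // mem_enum.
Qed.

Section ExteriorPower.

Variables (k : fieldType) (n : nat) (V : lmodType k) (L : vectType k).
Variables (wedge : n.-tuple V -> L).
Hypothesis wedgeP : exterior_power wedge.

(** Both maps are the factorisation of the same alternating map, which the
    universal property makes unique. *)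
Lemma wedge_ext (N : lmodType k) (g h : {linear L -> N}) :
  (forall v, g (wedge v) = h (wedge v)) -> g =1 h.
Proof.
have [[mw w0] univ] := wedgeP; move=> gh.
have altg : alternating_multilinear (fun v => g (wedge v)).
  split=> [i a u v w wE uvE|w i j ij wij].
    by rewrite (mw i a u v w) // linearP.
  by rewrite (w0 w i j) // linear0.
have [g0 _ g0P] := univ N _ altg.
by move=> x; rewrite (g0P g) // (g0P h).
Qed.

Variables (m : nat) (b : V -> V -> k) (e : 'I_m -> V) (d : 'I_m -> k).
Hypothesis dual_basis : forall x, x = \sum_j (b x (e j) / d j) *: e j.
Hypothesis bC : forall x y, b x y = b y x.
Variable eta : 'Hom(L, 'Hom(L, k^o)).
Hypothesis etaP : exterior_duality b wedge eta.
Hypothesis fact_neq0 : n`!%:R != 0 :> k.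

Let W (t : n.-tuple 'I_m) := wedge [tuple of map e t].
Let D (t : n.-tuple 'I_m) := \prod_i d (tnth t i).

(** The case of [gram_expand] where f is the exterior product. *)
Lemma eta_expand x : \sum_t ((D t)^-1 * eta x (W t)) *: W t = n`!%:R *: x.
Proof.
pose h y := \sum_t ((D t)^-1 * eta y (W t)) *: W t.
have lh : linear h.
  move=> a y z; rewrite /h scaler_sumr -big_split; apply: eq_bigr => t _ /=.
  by rewrite linearP add_lfunE scale_lfunE mulrDr scalerDl scalerA mulrCA.
pose hl := HB.pack_for {linear L -> L} h
  (GRing.isSemilinear.Build k L L *:%R h (GRing.semilinear_linear lh)).
apply: (@wedge_ext L hl ( *:%R n`!%:R)) => v /=.
rewrite -(gram_expand _ dual_basis); last by case: wedgeP.
by apply: eq_bigr => t _; rewrite etaP.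
Qed.

(** [eta_expand] shows that eta is injective.  That the right-hand side is a
    preimage of p follows by applying p to [eta_expand], because the Gram
    determinants are symmetric in their two families. *)
Lemma eta_invE (p : 'Hom(L, k^o)) :
  (eta^-1)%VF p = n`!%:R^-1 *: \sum_t ((D t)^-1 * p (W t)) *: W t.
Proof.
set x := RHS; have eta_inj : lker eta == 0%VS.
  apply/lker0P => y z eqyz; apply: (scalerI fact_neq0).
  by rewrite -!eta_expand eqyz.
suff <- : eta x = p by rewrite lker0_lfunK.
apply/lfunP; apply: wedge_ext => v; apply: (mulfI fact_neq0).
have := congr1 p (eta_expand (wedge v)); rewrite linearZ /= => eqp.
rewrite -[RHS]eqp /x linearZ /= linear_sum scale_lfunE mulrA mulfV // mul1r.
rewrite sum_lfunE linear_sum.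
apply: eq_bigr => t _; rewrite !linearZ /= scale_lfunE !etaP.
rewrite -det_tr; set A := \det _; set A' := \det _.
have -> : A = A' by congr (\det _); apply/matrixP => i j; rewrite !mxE bC.
exact: mulrAC.
Qed.

End ExteriorPower.

(** * The trace of an endomorphism *)

Section Trace.

Variables (k : fieldType) (V : vectType k).
Implicit Types (f g h : 'End(V)).

Lemma lfun_trace_is_linear : linear (@lfun_trace k V : _ -> k^o).
Proof.
by move=> l f g; rewrite /lfun_trace passmx.mxof_linear mxtraceD mxtraceZ.
Qed.

HB.instance Definition _ :=
  GRing.isSemilinear.Build k 'End(V) k^o _ (@lfun_trace k V)
  (GRing.semilinear_linear lfun_trace_is_linear).

Lemma lfun_traceD f g : lfun_trace (f + g) = lfun_trace f + lfun_trace g.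
Proof. exact: linearD. Qed.
Lemma lfun_traceN f : lfun_trace (- f) = - lfun_trace f.
Proof. exact: linearN. Qed.
Lemma lfun_traceZ l f : lfun_trace (l *: f) = l * lfun_trace f.
Proof. exact: linearZ. Qed.

Lemma lfun_traceC f g : lfun_trace (f \o g)%VF = lfun_trace (g \o f)%VF.
Proof.
by rewrite /lfun_trace !(passmx.mxof_comp _ _ (vbasisP {:V})) mxtrace_mulC.
Qed.

Lemma lfun_trace1 : lfun_trace (\1%VF : 'End(V)) = (\dim {:V})%:R.
Proof.
by rewrite /lfun_trace passmx.mxof1 ?(basis_free (vbasisP _)) // mxtrace1.
Qed.

Lemma lfun_trace_rank1 (p : {scalar V}) w f :
  (forall x, f x = p x *: w) -> lfun_trace f = p w.
Proof.
move=> fE; rewrite [w in RHS](coord_vbasis (memvf w)) linear_sum.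
apply: eq_bigr => i _; rewrite mxE /= passmx.vecof_delta fE linearZ /= mxE.
by rewrite linearZ /= mulrC.
Qed.

Lemma lfun_trace_compD f g h :
  lfun_trace (f \o (g + h))%VF = lfun_trace (f \o g)%VF + lfun_trace (f \o h)%VF.
Proof. by rewrite comp_lfunDr lfun_traceD. Qed.
Lemma lfun_trace_compN f g : lfun_trace (f \o (- g))%VF = - lfun_trace (f \o g)%VF.
Proof. by rewrite comp_lfunNr lfun_traceN. Qed.
Lemma lfun_trace_compZ l f g :
  lfun_trace (f \o (l *: g))%VF = l * lfun_trace (f \o g)%VF.
Proof. by rewrite -comp_lfunZr lfun_traceZ. Qed.

Definition lfun_trace_compE :=
  (lfun_trace_compD, lfun_trace_compN, lfun_trace_compZ).

End Trace.

(** * Octonion algebras *)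

Section Octonions.

Variables (k : fieldType) (char2 : 2%N \notin [pchar k]).
Variables (O : octonionAlgebra k).

Implicit Types (u v w x y z : O) (l : k).

Local Notation "u *o v" := (omul u v) (at level 40, left associativity).
Local Notation B := (@oform k O).
Local Notation e1 := (@o1 k O).

Lemma two_neq0 : 2%:R != 0 :> k.
Proof. by have := char2; rewrite inE /=. Qed.

Lemma four_neq0 : 4%:R != 0 :> k.
Proof. by rewrite (natrX k 2 2) expf_neq0 ?two_neq0. Qed.

Lemma eight_neq0 : 8%:R != 0 :> k.
Proof. by rewrite (natrX k 2 3) expf_neq0 ?two_neq0. Qed.

Lemma oformC u v : B u v = B v u.
Proof. by rewrite /oform /polar [u + v]addrC addrAC. Qed.

Lemma oform_linearl v : linear_for *%R (B^~ v).
Proof.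
have [_ [lin1 _]] := onorm_quadratic O.
by move=> a x y /=; rewrite /oform lin1 mulrDr mulrCA.
Qed.

Lemma oformDl u v w : B (u + v) w = B u w + B v w.
Proof. by have := oform_linearl w 1 u v; rewrite scale1r mul1r. Qed.
Lemma oform0l w : B 0 w = 0.
Proof. by apply: (addrI (B 0 w)); rewrite -oformDl !addr0. Qed.
Lemma oformZl l u w : B (l *: u) w = l * B u w.
Proof. by have := oform_linearl w l u 0; rewrite addr0 oform0l addr0. Qed.
Lemma oformNl u w : B (- u) w = - B u w.
Proof. by rewrite -scaleN1r oformZl mulN1r. Qed.
Lemma oformBl u v w : B (u - v) w = B u w - B v w.
Proof. by rewrite oformDl oformNl. Qed.

Lemma oformDr u v w : B w (u + v) = B w u + B w v.
Proof. by rewrite !(oformC w) oformDl. Qed.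
Lemma oform0r w : B w 0 = 0.
Proof. by rewrite oformC oform0l. Qed.
Lemma oformZr l u w : B w (l *: u) = l * B w u.
Proof. by rewrite !(oformC w) oformZl. Qed.
Lemma oformNr u w : B w (- u) = - B w u.
Proof. by rewrite !(oformC w) oformNl. Qed.
Lemma oformBr u v w : B w (u - v) = B w u - B w v.
Proof. by rewrite oformDr oformNr. Qed.

Definition oformE := (oformDl, oformNl, oformZl, oform0l,
                      oformDr, oformNr, oformZr, oform0r).

(** Turns an identity between vectors into one between scalars, which [ring] or
    [field] can settle. *)
Lemma oform_eqP u v : (forall t, B u t = B v t) -> u = v.
Proof.
move=> eqB; apply/eqP; rewrite -subr_eq0; apply/eqP.
apply: onorm_nondegenerate => t; have := eqB t.
rewrite -[polar _ _ _](mulVKf two_neq0) -/(oform _ _) oformBl => ->.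
by rewrite subrr mulr0.
Qed.

Lemma onormZ l u : onorm (l *: u) = l ^+ 2 * onorm u.
Proof. by have [-> _] := onorm_quadratic O. Qed.

Lemma oform_onorm u : B u u = onorm u.
Proof.
rewrite /oform /polar -[u + u](scaler_nat 2 u) onormZ.
by field; exact: two_neq0.
Qed.

Lemma onormD u v : onorm (u + v) = onorm u + onorm v + 2%:R * B u v.
Proof. by rewrite /oform /polar; field; exact: two_neq0. Qed.

Lemma omulDl u v w : (u + v) *o w = u *o w + v *o w.
Proof. exact: linearDl. Qed.
Lemma omulDr u v w : w *o (u + v) = w *o u + w *o v.
Proof. exact: linearDr. Qed.
Lemma omulNl u w : (- u) *o w = - (u *o w).
Proof. exact: linearNl. Qed.
Lemma omulNr u w : w *o (- u) = - (w *o u).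
Proof. exact: linearNr. Qed.
Lemma omulZl l u w : (l *: u) *o w = l *: (u *o w).
Proof. exact: linearZl_LR. Qed.
Lemma omulZr l u w : w *o (l *: u) = l *: (w *o u).
Proof. exact: linearZr_LR. Qed.
Lemma omul1 u : e1 *o u = u. Proof. exact: omul1l. Qed.
Lemma omulr1 u : u *o e1 = u. Proof. exact: omul1r. Qed.

Definition omulE :=
  (omulDl, omulNl, omulZl, omulDr, omulNr, omulZr, omul1, omulr1).

Lemma onorm1 : onorm e1 = 1.
Proof.
(* If q(1) = 0 then q = 0 by multiplicativity, against nondegeneracy. *)
have [/eqP n1|n1] := eqVneq (onorm e1) 0; last first.
  by apply: (mulfI n1); rewrite mulr1 -onormM omulr1.
have n0 u : onorm u = 0 by rewrite -[u]omul1 onormM (eqP n1) mul0r.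
have : (0 < \dim {: O})%N by rewrite oct_dim.
rewrite lt0n dimv_eq0 -vpick0; case/eqP.
by apply: onorm_nondegenerate => v; rewrite /polar !n0 !subr0.
Qed.

(** Multiplicativity of the norm, polarised in both factors; the adjunction
    formulas and the alternative laws are instances of it. *)
Lemma oform_omul2 u v w x :
  B (u *o v) (w *o x) + B (w *o v) (u *o x) = 2%:R * B u w * B v x.
Proof.
have pol a b c : B (a *o b) (a *o c) = onorm a * B b c.
  have := onormM a (b + c); rewrite omulDr !onormD !onormM => eqn.
  apply: (mulfI two_neq0); apply: (addrI (onorm a * onorm b + onorm a * onorm c)).
  by rewrite eqn; ring.
have := pol (u + w) v x; rewrite !omulDl onormD !oformE !pol.
set b1 := B (u *o v) _; set b2 := B (w *o v) _ => eq1.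
have -> : b1 + b2 = onorm u * B v x + b1 + (b2 + onorm w * B v x)
    - onorm u * B v x - onorm w * B v x.
  by ring.
by rewrite eq1; ring.
Qed.

Lemma adjl u x y : B (u *o x) y = B x (oconj u *o y).
Proof.
have := oform_omul2 u x e1 y; rewrite !omulE /oconj => /(canRL (addrK _)) ->.
by rewrite !oformE; ring.
Qed.

Lemma adjr u x y : B (x *o u) y = B x (y *o oconj u).
Proof.
have := oform_omul2 x u y e1; rewrite !omulE /oconj => /(canRL (addrK _)) ->.
by rewrite !oformE [B (y *o u) x]oformC; ring.
Qed.

Lemma oconjK u : oconj (oconj u) = u.
Proof.
by apply: oform_eqP => t; rewrite /oconj !oformE oform_onorm onorm1; ring.
Qed.

Lemma oform_conjl u v : B (oconj u) v = B (u *o v) e1.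
Proof. by rewrite [RHS]adjl omulr1; exact: oformC. Qed.

Lemma conj1 : oconj e1 = e1.
Proof.
by rewrite /oconj oform_onorm onorm1 mulr1 mulr2n scalerDl scale1r addrK.
Qed.

Lemma oconjM u v : oconj (u *o v) = oconj v *o oconj u.
Proof.
apply: oform_eqP => t; rewrite oform_conjl adjr omul1 adjl -adjr.
by rewrite [RHS]adjl oconjK; exact: oformC.
Qed.

Lemma conj_mulVl u v x :
  oconj u *o (v *o x) + oconj v *o (u *o x) = (2%:R * B u v) *: x.
Proof.
apply: oform_eqP => t; rewrite !oformE adjl oconjK [B (oconj v *o _) t]adjl oconjK.
by rewrite oform_omul2 [B v u]oformC.
Qed.

Lemma conj_mulVr u v x :
  (x *o oconj u) *o v + (x *o oconj v) *o u = (2%:R * B u v) *: x.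
Proof.
apply: (can_inj oconjK); rewrite linearD linearZ /= !oconjM !oconjK.
by rewrite addrC conj_mulVl.
Qed.

Lemma conj_im a : a \in imO O -> oconj a = - a.
Proof. by rewrite mem_imO => /eqP. Qed.

Lemma mem_imP a : reflect (B a e1 = 0) (a \in imO O).
Proof.
rewrite mem_imO /oconj -subr_eq0 opprK subrK scaler_eq0 mulf_eq0.
rewrite (negPf two_neq0) /=.
have /negPf -> : e1 != 0.
  apply/eqP => e0; have /eqP := onorm1.
  by rewrite -oform_onorm e0 oform0l eq_sym oner_eq0.
by rewrite orbF; apply: eqP.
Qed.

Lemma im_form1 a : a \in imO O -> B a e1 = 0.
Proof. by move/mem_imP. Qed.

Lemma im_skewl a x y : a \in imO O -> B (a *o x) y = - B x (a *o y).
Proof. by move=> /conj_im ca; rewrite adjl ca omulNl oformNr. Qed.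

Lemma im_skewr a x y : a \in imO O -> B (x *o a) y = - B x (y *o a).
Proof. by move=> /conj_im ca; rewrite adjr ca omulNr oformNr. Qed.

Lemma im_mull a b x : a \in imO O -> b \in imO O ->
  a *o (b *o x) = - (b *o (a *o x)) - (2%:R * B a b) *: x.
Proof.
move=> /conj_im ca /conj_im cb; rewrite -conj_mulVl ca cb !omulNl opprD !opprK.
by rewrite addrCA addNr addr0.
Qed.

Lemma im_mulC a b : a \in imO O -> b \in imO O ->
  a *o b = - (b *o a) - (2%:R * B a b) *: e1.
Proof. by move=> aI bI; have := im_mull e1 aI bI; rewrite !omulr1. Qed.

Lemma im_mulr a b x : a \in imO O -> b \in imO O ->
  (x *o a) *o b = - ((x *o b) *o a) - (2%:R * B a b) *: x.
Proof.
move=> /conj_im ca /conj_im cb; rewrite -conj_mulVr ca cb.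
rewrite !(omulNl, omulNr) opprD !opprK.
by rewrite addrCA addNr addr0.
Qed.

Lemma cross_im a b : a \in imO O -> b \in imO O ->
  cross a b = 2%:R^-1 *: (a *o b - b *o a).
Proof.
by move=> /conj_im ca /conj_im cb; rewrite /cross ca cb !omulNl opprK addrC.
Qed.

Lemma crossE a b : a \in imO O -> b \in imO O ->
  cross a b = a *o b + B a b *: e1.
Proof.
move=> aI bI; rewrite cross_im // (im_mulC bI aI) opprD !opprK addrA -mulr2n.
rewrite -scaler_nat scalerDr !scalerA mulVf ?two_neq0 // scale1r oformC.
by rewrite mulKf ?two_neq0.
Qed.

Lemma cross_imO a b : a \in imO O -> b \in imO O -> cross a b \in imO O.
Proof.
move=> aI bI; apply/mem_imP; rewrite crossE // !oformE im_skewl // omulr1.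
by rewrite oform_onorm onorm1 mulr1 oformC addNr.
Qed.

Lemma crossC a b : a \in imO O -> b \in imO O -> cross a b = - cross b a.
Proof. by move=> aI bI; rewrite !cross_im // -scalerN opprB. Qed.

Lemma phiE a b c : a \in imO O -> b \in imO O -> c \in imO O ->
  phi a b c = B a (b *o c).
Proof.
by move=> aI bI cI; rewrite /phi crossE // !oformE im_form1 // mulr0 addr0.
Qed.

Lemma phi_cycle a b c : a \in imO O -> b \in imO O -> c \in imO O ->
  phi a b c = phi b c a.
Proof. 
by move=> aI bI cI; rewrite !phiE // oformC im_skewl // -[LHS]im_skewr // oformC.
Qed.

Lemma phi_swap a b c : b \in imO O -> c \in imO O -> phi a b c = - phi a c b.
Proof. by move=> bI cI; rewrite /phi crossC // oformNr. Qed.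

(** Both products in the associator are replaced by cross-products, and
    a (b x c) is turned around by the anticommutation of imaginary elements;
    this produces an expression whose cyclic sum is easy. *)
Lemma associator_cross a b c : a \in imO O -> b \in imO O -> c \in imO O ->
  associator a b c = cross a b *o c + cross b c *o a + (B b c *: a - B a b *: c)
    + (2%:R * phi a b c) *: e1.
Proof.
move=> aI bI cI; rewrite /associator /phi.
have -> : b *o c = cross b c - B b c *: e1 by rewrite crossE // addrK.
have -> : a *o b = cross a b - B a b *: e1 by rewrite crossE // addrK.
have := im_mulC aI (cross_imO bI cI).
move: (cross a b) (cross b c) => d f eqf; rewrite !omulE eqf.
by apply: oform_eqP => t; rewrite !oformE; ring.
Qed.

Lemma im_associatorC a b c : a \in imO O -> b \in imO O ->
  associator a b c = - associator b a c.
Proof.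
move=> aI bI; rewrite /associator (im_mull _ aI bI) (im_mulC aI bI) !omulE.
rewrite [RHS]opprB.
by apply: oform_eqP => t; rewrite !oformE; ring.
Qed.

Lemma im_associatorAC a b c : b \in imO O -> c \in imO O ->
  associator a b c = - associator a c b.
Proof.
move=> bI cI; rewrite /associator (im_mulr _ bI cI) (im_mulC bI cI) !omulE.
rewrite [RHS]opprB.
by apply: oform_eqP => t; rewrite !oformE; ring.
Qed.

Lemma associator_cycle a b c : a \in imO O -> b \in imO O -> c \in imO O ->
  associator a b c = associator b c a.
Proof.
by move=> aI bI cI; rewrite im_associatorC // im_associatorAC // opprK.
Qed.

(** The defect of the Jacobi identity for the cross-product: the cyclic sum of
    [associator_cross], in which the terms in a, b, c cancel while the
    associator and [phi] are cyclically invariant. *)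
Lemma jacobi_cross a b c : a \in imO O -> b \in imO O -> c \in imO O ->
  2%:R *: (cross (cross a b) c + cross (cross b c) a + cross (cross c a) b)
    = 3%:R *: associator a b c.
Proof.
move=> aI bI cI.
have E1 := associator_cross aI bI cI; have E2 := associator_cross bI cI aI.
have E3 := associator_cross cI aI bI.
rewrite -(associator_cycle aI bI cI) in E2.
rewrite -(associator_cycle bI cI aI) -(associator_cycle aI bI cI) in E3.
have f1 := phi_cycle aI bI cI; have f2 := phi_cycle bI cI aI.
rewrite f1 in E1; rewrite -f2 -f1 in E3.
have crE d x : d \in imO O -> x \in imO O -> cross d x = d *o x + B x d *: e1.
  by move=> dI xI; rewrite crossE // oformC.
have -> (z : O) : 3%:R *: z = z + z + z.
  by apply: oform_eqP => t; rewrite !oformE; ring.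
rewrite {1}E1 {1}E2 {1}E3 !(crE (cross _ _)) ?cross_imO //.
rewrite -!/(phi _ _ _) -f2 -f1.
apply: oform_eqP => t; rewrite !oformE.

by ring.
Qed.

(** Reduces statements about all octonions to imaginary ones and to 1. *)
Lemma im_split x : {c | c \in imO O & x = c + B x e1 *: e1}.
Proof.
exists (x - B x e1 *: e1); last by rewrite subrK.
by apply/mem_imP; rewrite !oformE oform_onorm onorm1 mulr1 subrr.
Qed.

(** The infinitesimal rotation in the plane of a and b, expressed through
    multiplications: 4 E(a,b) = [L_a, L_b] - R_[a,b]. *)
Lemma commutator_rank2 a b x : a \in imO O -> b \in imO O ->
  a *o (b *o x) - b *o (a *o x) - x *o (a *o b - b *o a)
    = 4%:R *: (B a x *: b - B b x *: a).
Proof.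
move=> aI bI; have [c cI ->] := im_split x; move: (B x e1) => l.
rewrite !omulE (im_mull _ cI aI) (im_mull _ cI bI).
rewrite (im_mulC cI aI) (im_mulC cI bI) !omulE; apply: oform_eqP => t.
rewrite !oformE !(im_form1 aI) !(im_form1 bI) [B c a]oformC [B c b]oformC.
by ring.
Qed.
(** * Skew endomorphisms of the octonions *)

Definition Lmul a : 'End(O) := linfun (omul a).
Definition Rmul a : 'End(O) := linfun (applyr omul a).

Lemma LmulE a x : Lmul a x = a *o x. Proof. by rewrite lfunE. Qed.
Lemma RmulE a x : Rmul a x = x *o a. Proof. by rewrite lfunE. Qed.

Fact oform_is_scalar v : scalar (B v).
Proof. by move=> l x y; rewrite /= !oformE. Qed.
HB.instance Definition _ v := GRing.isSemilinear.Build k O k _ (B v)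
  (GRing.semilinear_linear (oform_is_scalar v)).

Definition rank1 v w x : O := B v x *: w.
Fact rank1_is_linear v w : linear (rank1 v w).
Proof. by move=> l x y; rewrite /rank1 !oformE scalerDl scalerA. Qed.
HB.instance Definition _ v w := GRing.isSemilinear.Build k O O _ (rank1 v w)
  (GRing.semilinear_linear (rank1_is_linear v w)).

Definition rank2 v w : 'End(O) := linfun (rank1 v w \- rank1 w v).

Lemma rank2E v w x : rank2 v w x = B v x *: w - B w x *: v.
Proof. by rewrite lfunE. Qed.

Definition lfE :=
  (rank2E, LmulE, RmulE, add_lfunE, opp_lfunE, scale_lfunE, comp_lfunE, id_lfunE).

Definition skew (W : 'End(O)) := forall x y, B (W x) y = - B x (W y).

Lemma skewB W W' : skew W -> skew W' -> skew (W - W').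
Proof. by move=> sW sW' x y; rewrite !lfE !oformE sW sW'; ring. Qed.
Lemma skewD W W' : skew W -> skew W' -> skew (W + W').
Proof. by move=> sW sW' x y; rewrite !lfE !oformE sW sW'; ring. Qed.
Lemma skewZ l W : skew W -> skew (l *: W).
Proof. by move=> sW x y; rewrite !lfE !oformE sW; ring. Qed.
Lemma skew_Lmul a : a \in imO O -> skew (Lmul a).
Proof. by move=> aI x y; rewrite !lfE im_skewl. Qed.
Lemma skew_Rmul a : a \in imO O -> skew (Rmul a).
Proof. by move=> aI x y; rewrite !lfE im_skewr. Qed.
Lemma skew_rank2 v w : skew (rank2 v w).
Proof. by move=> x y; rewrite !lfE !oformE [B x w]oformC [B x v]oformC; ring. Qed.

Local Notation tr := (@lfun_trace k O).

(** Links the trace form to the form (x v, w) that defines moment maps. *)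
Lemma tr_rank2 W v w : skew W -> tr (W \o rank2 v w)%VF = - 2%:R * B (W v) w.
Proof.
move=> sW.
have -> : (W \o rank2 v w)%VF = linfun (rank1 v (W w)) - linfun (rank1 w (W v)).
  by apply/lfunP => x; rewrite !lfE !lfunE linearB !linearZ.
rewrite lfun_traceD lfun_traceN.
have tr1 y z : tr (linfun (rank1 y z)) = B y z.
  by apply: (@lfun_trace_rank1 _ _ (B y : {scalar O})) => x; rewrite lfunE.
rewrite !tr1.
by rewrite /= sW [B w _]oformC sW; ring.
Qed.

Definition commL a b : 'End(O) := (Lmul a \o Lmul b)%VF - (Lmul b \o Lmul a)%VF.

Lemma commLE a b x : commL a b x = a *o (b *o x) - b *o (a *o x).
Proof. by rewrite !lfE. Qed.

(** Rotations in planes through 1 give access to right multiplications. *)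
Lemma rank2_1 a : a \in imO O -> Lmul a + Rmul a = 2%:R *: rank2 e1 a.
Proof.
move=> aI; apply/lfunP => x; rewrite !lfE; have [c cI ->] := im_split x.
rewrite !omulE (im_mulC cI aI); move: (B x e1) => l.
apply: oform_eqP => t; rewrite !oformE oform_onorm onorm1 [B e1 c]oformC.
by rewrite !im_form1 // [B c a]oformC; ring.
Qed.

Lemma commL_rank2 a b : a \in imO O -> b \in imO O ->
  commL a b = 4%:R *: rank2 a b + Rmul (a *o b - b *o a).
Proof.
move=> aI bI; apply/lfunP => x; rewrite 2!add_lfunE !scale_lfunE rank2E.
by rewrite -commutator_rank2 // !lfE subrK.
Qed.

Lemma skew_commL a b : a \in imO O -> b \in imO O -> skew (commL a b).
Proof. by move=> aI bI x y; rewrite !commLE !oformE !im_skewl //; ring. Qed.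

Lemma tr_LmulL a b : a \in imO O -> b \in imO O ->
  tr (Lmul a \o Lmul b)%VF = - 8%:R * B a b.
Proof.
move=> aI bI; apply: (mulfI two_neq0).
rewrite mulr_natl mulr2n [X in X + _]lfun_traceC -lfun_traceD.
have -> : (Lmul b \o Lmul a)%VF + (Lmul a \o Lmul b)%VF = (- 2%:R * B a b) *: \1%VF.
  apply/lfunP => x; rewrite !lfE (im_mull _ aI bI).
  by apply: oform_eqP => t; rewrite !oformE; ring.
by rewrite lfun_traceZ lfun_trace1 oct_dim; ring.
Qed.

Lemma tr_RmulR a b : a \in imO O -> b \in imO O ->
  tr (Rmul a \o Rmul b)%VF = - 8%:R * B a b.
Proof.
move=> aI bI; apply: (mulfI two_neq0).
rewrite mulr_natl mulr2n [X in X + _]lfun_traceC -lfun_traceD.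
have -> : (Rmul b \o Rmul a)%VF + (Rmul a \o Rmul b)%VF = (- 2%:R * B a b) *: \1%VF.
  apply/lfunP => x; rewrite !lfE (im_mulr _ aI bI).
  by apply: oform_eqP => t; rewrite !oformE; ring.
by rewrite lfun_traceZ lfun_trace1 oct_dim; ring.
Qed.

Lemma tr_LmulR a b : a \in imO O -> b \in imO O ->
  tr (Lmul a \o Rmul b)%VF = 4%:R * B a b.
Proof.
move=> aI bI.
have -> : Rmul b = 2%:R *: rank2 e1 b - Lmul b by rewrite -rank2_1 // addrC addKr.
rewrite !lfun_trace_compE.
by rewrite tr_LmulL // tr_rank2; [rewrite LmulE omulr1; ring | exact: skew_Lmul].
Qed.

Lemma comm_imO a b : a \in imO O -> b \in imO O -> a *o b - b *o a \in imO O.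
Proof.
move=> aI bI; have -> : a *o b - b *o a = 2%:R *: cross a b.
  by rewrite cross_im // scalerA mulfV ?two_neq0 // scale1r.
by rewrite memvZ // cross_imO.
Qed.

(** The left multiplications are orthogonal to the spin algebra. *)
Lemma tr_Lmul_commL a b c : a \in imO O -> b \in imO O -> c \in imO O ->
  tr (Lmul c \o commL a b)%VF = 0.
Proof.
move=> aI bI cI; rewrite commL_rank2 // !lfun_trace_compE.
rewrite tr_rank2; last exact: skew_Lmul.
rewrite tr_LmulR ?comm_imO // LmulE im_skewr // (im_mulC aI bI) !oformE.
by rewrite (im_form1 cI); ring.
Qed.

(** Nondegeneracy of the trace form, in the shape needed to identify moment maps.
    With r = W 1, orthogonality to the L_c evaluates Tr(W R_w) through
    [rank2_1], and then orthogonality to the [L_a, L_b] forces W = R_r by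
    [commL_rank2]; but Tr(L_c R_r) = 4 B(c, r). *)
Lemma skew_eq0 W : skew W ->
  (forall a b, a \in imO O -> b \in imO O -> tr (W \o commL a b)%VF = 0) ->
  (forall c, c \in imO O -> tr (W \o Lmul c)%VF = 0) ->
  W = 0.
Proof.
move=> sW trC trL; set r := W e1.
have r1 : B r e1 = 0.
  have := sW e1 e1; rewrite -/r [B e1 r]oformC => eqr.
  by apply: (mulfI two_neq0); rewrite mulr0 mulr_natl mulr2n {1}eqr addNr.
have rI : r \in imO O by apply/mem_imP.
have trR w : w \in imO O -> tr (W \o Rmul w)%VF = - 4%:R * B r w.
  move=> wI; have -> : Rmul w = 2%:R *: rank2 e1 w - Lmul w.
    by rewrite -rank2_1 // addrC addKr.
  rewrite !lfun_trace_compE.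
  by rewrite trL // tr_rank2 // -/r; ring.
have Wim a b : a \in imO O -> b \in imO O -> B (W a) b = B (a *o r) b.
  move=> aI bI; have := trC a b aI bI.
  rewrite commL_rank2 // !lfun_trace_compE tr_rank2 //.
  rewrite trR ?comm_imO // oformBr.
  rewrite -[B r (a *o b)]opprK -(im_skewl r b aI).
  rewrite -[B r (b *o a)]opprK -(im_skewr r b aI).
  rewrite (im_mulC rI aI) !oformE [B e1 b]oformC im_form1 // => eqB.
  apply/eqP; rewrite -subr_eq0 -(mulrI_eq0 _ (lregP eight_neq0)); apply/eqP.
  by rewrite -[RHS]oppr0 -[in RHS]eqB; ring.
have WR : W = Rmul r.
  apply/lfunP => x; have [c cI ->] := im_split x; move: (B x e1) => l.
  rewrite !linearD !linearZ /= !RmulE omul1 -/r; congr (_ + _).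
  apply: oform_eqP => t; have [d dI ->] := im_split t; move: (B t e1) => m.
  rewrite !oformDr !oformZr Wim // sW -/r [B (c *o r) e1]im_skewl // omulr1.
  by rewrite [B r c]oformC.
have r0 : r = 0.
  apply: oform_eqP => t; have [c cI ->] := im_split t.
  rewrite oform0l oformDr oformZr r1.
  have /eqP := trL c cI; rewrite WR lfun_traceC tr_LmulR // mulf_eq0.
  by rewrite (negPf four_neq0) /= oformC => /eqP ->; rewrite mulr0 addr0.
by rewrite WR r0; apply/lfunP => x; rewrite RmulE lfunE linear0r.
Qed.

(** * The two moment maps *)

Hypothesis char3 : 3%N \notin [pchar k].
Variables (C : falgType k) (iota : {linear subvs_of (imO O) -> C}).
Variables (rho : {linear C -> 'End(O)}) (rho_ext : left_mul_extension iota rho).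
Variables (muO : O -> O -> C) (muO_moment : moment_map_O iota rho muO).
Variables (muIm : O -> O -> C) (muIm_moment : moment_map_Im iota rho muIm).

Lemma three_neq0 : 3%:R != 0 :> k.
Proof. by have := char3; rewrite inE /=. Qed.

Lemma rho_commutator (u v : subvs_of (imO O)) :
  rho (iota u * iota v - iota v * iota u) = commL (vsval u) (vsval v).
Proof.
have [[_ rhoM] rhoI] := rho_ext.
have rhoL a : rho (iota a) = Lmul (vsval a) by apply/lfunP => x; rewrite rhoI LmulE.
by rewrite linearB /= !rhoM !rhoL.
Qed.

Lemma lie_h_commL a b : a \in imO O -> b \in imO O ->
  exists2 y, y \in lie_h iota & rho y = commL a b.
Proof.
move=> aI bI; pose u := vsproj (imO O) a; pose v := vsproj (imO O) b.
exists (iota u * iota v - iota v * iota u); first exact: mem_clifford2.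
by rewrite rho_commutator !vsprojK.
Qed.

Lemma lie_h_ind (P : C -> Prop) :
  P 0 -> (forall l (x y : C), P x -> P y -> P (l *: x + y)) ->
  (forall u v : subvs_of (imO O), P (iota u * iota v - iota v * iota u)) ->
  forall y : C, y \in lie_h iota -> P y.
Proof.
move=> P0 PD PC y yh; pose X := [seq iota p * iota r - iota r * iota p
  | p <- vbasis {:subvs_of (imO O)}, r <- vbasis {:subvs_of (imO O)}].
have /coord_span -> : y \in <<in_tuple X>>%VS by [].
elim/big_rec: _ => // i z _ Pz; apply: PD => //.
have : (i < size X)%N by [].
by move/(mem_nth 0)/allpairsP => [[u v] [_ _ ->]].
Qed.

Lemma skew_lie_h (y : C) : y \in lie_h iota -> skew (rho y).
Proof.
move: y; apply: lie_h_ind => [|l x y sx sy|u v].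
- by rewrite linear0 => x y; rewrite !lfunE oform0l oform0r oppr0.
- by rewrite linearD linearZ; apply: skewD => //; apply: skewZ.
by rewrite rho_commutator; apply: skew_commL; apply: subvsP.
Qed.

Lemma tr_Lmul_lie_h (y : C) c : y \in lie_h iota -> c \in imO O ->
  tr (Lmul c \o rho y)%VF = 0.
Proof.
move=> + cI; move: y; apply: lie_h_ind => [|l x y sx sy|u v].
- by rewrite linear0 comp_lfun0r; exact: linear0.
- by rewrite linearD linearZ /= !lfun_trace_compE sx sy mulr0 addr0.
by rewrite rho_commutator tr_Lmul_commL //; apply: subvsP.
Qed.

(** In particular the elements of g are orthogonal to the right
    multiplications. *)
Lemma tr_Rmul_lie_h (y : C) c : y \in lie_h iota -> c \in imO O ->
  tr (rho y \o Rmul c)%VF = - 4%:R * B (rho y e1) c.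
Proof.
move=> yh cI; have -> : Rmul c = 2%:R *: rank2 e1 c - Lmul c.
  by rewrite -rank2_1 // addrC addKr.
rewrite !lfun_trace_compE tr_rank2; last exact: skew_lie_h.
by rewrite [tr (_ \o Lmul c)%VF]lfun_traceC tr_Lmul_lie_h //; ring.
Qed.

Lemma mul_conj_im v w : w *o oconj v - B w v *: e1 \in imO O.
Proof.
apply/mem_imP; rewrite !oformE [B (w *o _) e1]oformC -adjr omul1 oform_onorm onorm1.
by rewrite [B v w]oformC; ring.
Qed.

(** The right-hand side pairs with h as the moment map does, and the multiple of
    L makes it orthogonal to the left multiplications; [skew_eq0] then applies
    to the difference. *)
Lemma rho_muO v w : rho (muO v w) =
  (4%:R / 3%:R) *: rank2 v w - 3%:R^-1 *: Lmul (w *o oconj v - B w v *: e1).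
Proof.
have dI := mul_conj_im v w; set d := _ - _ *: e1 in dI *.
have Bd c : c \in imO O -> B c d = B (c *o v) w.
  by move=> cI; rewrite !oformE -adjr im_form1 //; ring.
move: d dI Bd => d dI Bd.
have [muh muE] := muO_moment (memvf v) (memvf w).
apply/eqP; rewrite -subr_eq0; apply/eqP; apply: skew_eq0.
- apply: skewB; first exact: skew_lie_h.
  by apply: skewB; apply: skewZ; [exact: skew_rank2 | exact: skew_Lmul].
- move=> a b aI bI; rewrite lfun_traceC !lfun_trace_compE.
  rewrite tr_rank2; last exact: skew_commL.
  rewrite [tr (commL a b \o Lmul d)%VF]lfun_traceC tr_Lmul_commL //.
  have [y yh ry] := lie_h_commL aI bI; have := muE y yh.
  rewrite /form_h ry => <-.
  by field; rewrite three_neq0 eight_neq0.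
move=> c cI; rewrite lfun_traceC !lfun_trace_compE tr_rank2; last exact: skew_Lmul.
by rewrite tr_Lmul_lie_h // tr_LmulL // Bd // LmulE; field; rewrite three_neq0.
Qed.

Lemma rho_muOE v w x : rho (muO v w) x =
  (4%:R / 3%:R) *: (B v x *: w - B w x *: v)
   - 3%:R^-1 *: ((w *o oconj v) *o x - B w v *: x).
Proof.
rewrite rho_muO add_lfunE opp_lfunE !scale_lfunE rank2E LmulE.
by rewrite omulDl omulNl omulZl omul1.
Qed.

Lemma lie_gP (y : C) :
  reflect (y \in lie_h iota /\ rho y e1 = 0) (y \in lie_g iota rho).
Proof. by rewrite inE; apply: (iffP andP) => -[? /eqP]. Qed.

(** The difference W of both sides is orthogonal to g and to all the left and
    right multiplications.  A commutator y = [L_a, L_b] need not be in g, but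
    mu_O(1, y 1) acts as a combination of L and R and sends 1 to y 1, so that
    y - mu_O(1, y 1) is in g; hence W is orthogonal to y as well. *)
Lemma rho_muIm v w : v \in imO O -> w \in imO O -> rho (muIm v w) =
  (3%:R / 2%:R) *: rank2 v w - 4%:R^-1 *: (Lmul (cross v w) - Rmul (cross v w)).
Proof.
move=> vI wI; have dI := cross_imO vI wI; have dE := crossE vI wI.
move: (cross v w) dI dE => d dI dE.
have Bd c : c \in imO O -> B c d = B (c *o v) w.
  move=> cI; rewrite dE !oformE [B c e1]im_form1 // im_skewr //.
  by rewrite (im_mulC wI vI) !oformE [B c e1]im_form1 //; ring.
have Bd' c : c \in imO O -> B c d = - B (v *o c) w.
  by move=> cI; rewrite dE !oformE [B c e1]im_form1 // im_skewl //; ring.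
have [/lie_gP [muh mu1] muE] := muIm_moment vI wI.
apply/eqP; rewrite -subr_eq0; apply/eqP; set W := _ - _.
have sW : skew W.
  apply: skewB; first exact: skew_lie_h.
  apply: skewB; apply: skewZ; first exact: skew_rank2.
  by apply: skewB; [exact: skew_Lmul | exact: skew_Rmul].
have trL c : c \in imO O -> tr (W \o Lmul c)%VF = 0.
  move=> cI; rewrite lfun_traceC !lfun_trace_compE tr_rank2; last exact: skew_Lmul.
  rewrite tr_Lmul_lie_h // tr_LmulL // tr_LmulR // LmulE -Bd //.
  by field; rewrite four_neq0 two_neq0.
have trR c : c \in imO O -> tr (W \o Rmul c)%VF = 0.
  move=> cI; rewrite lfun_traceC !lfun_trace_compE tr_rank2; last exact: skew_Rmul.
  rewrite [tr (Rmul c \o rho _)%VF]lfun_traceC tr_Rmul_lie_h // mu1 oform0l.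
  rewrite [tr (Rmul c \o Lmul d)%VF]lfun_traceC.
  rewrite tr_LmulR // tr_RmulR // RmulE [B d c]oformC Bd' //.
  by field; rewrite four_neq0 two_neq0.
have trg (y : C) : y \in lie_g iota rho -> tr (W \o rho y)%VF = 0.
  move=> yg; have /lie_gP [yh y1] := yg.
  rewrite lfun_traceC !lfun_trace_compE tr_rank2; last exact: skew_lie_h.
  rewrite [tr (_ \o Lmul d)%VF]lfun_traceC tr_Lmul_lie_h // tr_Rmul_lie_h //.
  rewrite y1 oform0l.
  rewrite -(muE y yg) /form_g; field.
  by rewrite four_neq0 three_neq0 two_neq0.
apply: skew_eq0 => // a b aI bI.
have [y yh ry] := lie_h_commL aI bI.
set c := a *o b - b *o a; have cI : c \in imO O := comm_imO aI bI.
have [mOh _] := muO_moment (memvf e1) (memvf c).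
have y1 : rho y e1 = c by rewrite ry commLE !omulr1.
have zg : y - muO e1 c \in lie_g iota rho.
  apply/lie_gP; split; first exact: rpredB.
  rewrite linearB add_lfunE opp_lfunE y1 rho_muOE conj1 !omulr1.
  move: (c) cI => c' /im_form1 c1; rewrite oform_onorm onorm1 c1.
  by apply: oform_eqP => t; rewrite !oformE; field; rewrite three_neq0.
have := trg _ zg; rewrite linearB /= !lfun_trace_compE ry rho_muO !lfun_trace_compE.
rewrite trL ?mul_conj_im // => /eqP; rewrite mulr0 subr0 subr_eq0 => /eqP ->.
rewrite (_ : rank2 e1 c = 2%:R^-1 *: (Lmul c + Rmul c)).
  by rewrite !lfun_trace_compE trL // trR // !(addr0, mulr0).
by rewrite rank2_1 // scalerA mulVf ?two_neq0 // scale1r.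
Qed.

Lemma rho_muImE u v w : u \in imO O -> v \in imO O -> w \in imO O ->
  rho (muIm u v) w =
    (3%:R / 2%:R) *: (B u w *: v - B v w *: u) - 2%:R^-1 *: cross (cross u v) w.
Proof.
move=> uI vI wI; rewrite rho_muIm // [in RHS]cross_im ?cross_imO //.
rewrite add_lfunE opp_lfunE !scale_lfunE add_lfunE opp_lfunE.
rewrite rank2E LmulE RmulE scalerA.
by congr (_ - _ *: _); field; rewrite two_neq0 four_neq0.
Qed.

(** * The covariants *)

Lemma mul_swap_cross u v w : u \in imO O -> v \in imO O -> w \in imO O ->
  (v *o u) *o w = - cross (cross u v) w + phi u v w *: e1 - B u v *: w.
Proof.
move=> uI vI wI.
have -> : v *o u = - cross u v - B u v *: e1.
  by rewrite crossE // (im_mulC vI uI) [B v u]oformC;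
     apply: oform_eqP => t; rewrite !oformE; ring.
rewrite [in RHS]crossE ?cross_imO // (phi_cycle uI vI wI) (phi_cycle vI wI uI) /phi.
rewrite [B w _]oformC.
move: (cross u v) => d; rewrite !omulE.
by apply: oform_eqP => t; rewrite !oformE; ring.
Qed.

Lemma associator_jacobi u v w : u \in imO O -> v \in imO O -> w \in imO O ->
  associator u v w = (2%:R / 3%:R) *:
    (cross (cross u v) w + cross (cross v w) u + cross (cross w u) v).
Proof.
move=> uI vI wI; rewrite mulrC -scalerA jacobi_cross // scalerA.
by rewrite mulVf ?three_neq0 // scale1r.
Qed.

Lemma associator_im u v w : u \in imO O -> v \in imO O -> w \in imO O ->
  associator u v w \in imO O.
Proof.
by move=> uI vI wI; rewrite associator_jacobi // memvZ // !memvD // !cross_imO.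
Qed.

Lemma psiO_im u v w : u \in imO O -> v \in imO O -> w \in imO O ->
  cov_psi rho muO u v w = - (1 / 2%:R) *: associator u v w + phi u v w *: e1.
Proof.
move=> uI vI wI; rewrite /cov_psi !rho_muOE !conj_im // !omulNr !omulNl.
rewrite !mul_swap_cross //.
have -> : phi w u v = phi u v w by rewrite -phi_cycle // -phi_cycle.
rewrite -(phi_cycle uI vI wI).
rewrite associator_jacobi //.
move: (cross _ w) (cross _ u) (cross _ v) (phi u v w) => x y z p.
apply: oform_eqP => t.
rewrite !oformE [B v u]oformC [B w u]oformC [B w v]oformC; field.
by rewrite three_neq0 two_neq0.
Qed.

Lemma psiO_1 u v : u \in imO O -> v \in imO O ->
  cov_psi rho muO u v e1 = - cross u v.
Proof.
move=> uI vI; rewrite /cov_psi !rho_muOE conj1 !conj_im //.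
rewrite !omulNr !omulNl !omul1 !omulr1.
rewrite crossE // (im_mulC vI uI) [B v u]oformC ![B e1 _]oformC !im_form1 //.
by apply: oform_eqP => t; rewrite !oformE; field; rewrite three_neq0.
Qed.

Lemma psiIm_im u v w : u \in imO O -> v \in imO O -> w \in imO O ->
  cov_psi rho muIm u v w = - (3%:R / 4%:R) *: associator u v w.
Proof.
move=> uI vI wI; rewrite /cov_psi !rho_muImE //.
rewrite associator_jacobi //; move: (cross _ w) (cross _ u) (cross _ v) => x y z.
apply: oform_eqP => t.
rewrite !oformE [B v u]oformC [B w u]oformC [B w v]oformC; field.
by rewrite three_neq0 two_neq0 four_neq0.
Qed.

Lemma cov_psi_cycle (L : lmodType k) (act : L -> 'End(O)) (mu : O -> O -> L) u v w :
  cov_psi act mu u v w = cov_psi act mu v w u.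
Proof. by rewrite /cov_psi addrC addrA. Qed.

Lemma QO_im v1 v2 v3 v4 :
  v1 \in imO O -> v2 \in imO O -> v3 \in imO O -> v4 \in imO O ->
  cov_Q rho B muO v1 v2 v3 v4 = 2%:R / 3%:R * cov_Q rho B muIm v1 v2 v3 v4.
Proof.
move=> I1 I2 I3 I4; rewrite /cov_Q !psiO_im // !psiIm_im //.
move: (associator _ _ v4) (associator _ _ v3) => x4 x3.
move: (associator _ _ v2) (associator _ _ v1) => x2 x1.
rewrite !oformE !im_form1 //; field.
by rewrite three_neq0 two_neq0 four_neq0.
Qed.

Lemma QO_1 u v w : u \in imO O -> v \in imO O -> w \in imO O ->
  cov_Q rho B muO u v w e1 = - 4%:R * phi u v w.
Proof.
move=> uI vI wI; rewrite /cov_Q (cov_psi_cycle _ _ e1).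
rewrite [cov_psi _ _ w e1 u]cov_psi_cycle.
rewrite [cov_psi _ _ e1 u w]cov_psi_cycle.
rewrite !psiO_1 // psiO_im // !oformNr -!/(phi _ _ _).
rewrite (phi_swap v uI wI) -(phi_cycle uI vI wI) (phi_cycle wI uI vI).
have := im_form1 (associator_im uI vI wI); rewrite oformC.
move: (associator u v w) => A A1; rewrite !oformE A1 oform_onorm onorm1.
by field; exact: two_neq0.
Qed.

(** Orthogonal elements behave as if they anticommuted; consequently
    (u conj v) w is alternating on orthogonal triples. *)
Lemma mul_conjC u v : B u v = 0 -> u *o oconj v = - (v *o oconj u).
Proof.
move=> uv0; rewrite -[v in RHS]oconjK -oconjM {2}/oconj.
by rewrite [B (u *o _) e1]oformC -adjr omul1 oformC uv0 mulr0 scale0r sub0r opprK.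
Qed.

Lemma mul_conjAC u v w : B u v = 0 ->
  (w *o oconj u) *o v = - ((w *o oconj v) *o u).
Proof.
move=> uv0; apply/eqP; rewrite -addr_eq0 conj_mulVr uv0 mulr0 scale0r //.
Qed.

(** The three cyclic products agree on orthogonal triples. *)
Lemma psiO_orthogonal u v w : B u v = 0 -> B u w = 0 -> B v w = 0 ->
  cov_psi rho muO u v w = (u *o oconj v) *o w.
Proof.
move=> uv uw vw; rewrite /cov_psi !rho_muOE ![B w _]oformC [B v u]oformC uv uw vw.
rewrite [v *o _]mul_conjC 1?oformC // !omulNl.
rewrite (mul_conjAC _ (eq_trans (oformC _ _) vw)).
rewrite [w *o _]mul_conjC 1?oformC // omulNl.
rewrite [(v *o _) *o u]mul_conjAC 1?oformC //.
rewrite [v *o oconj u]mul_conjC 1?oformC // omulNl.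
by apply: oform_eqP => t; rewrite !oformE; field; exact: three_neq0.
Qed.

(** The four terms of Q agree, by moving the last factor of [psiO_orthogonal]
    across the form. *)
Lemma QO_orthogonal v1 v2 v3 v4 :
  B v1 v2 = 0 -> B v1 v3 = 0 -> B v1 v4 = 0 ->
  B v2 v3 = 0 -> B v2 v4 = 0 -> B v3 v4 = 0 ->
  cov_Q rho B muO v1 v2 v3 v4 = 4%:R * B (v1 *o oconj v4) (v2 *o oconj v3).
Proof.
move=> o12 o13 o14 o23 o24 o34.
rewrite /cov_Q [cov_psi _ _ v1 v2 v3]cov_psi_cycle.
rewrite [cov_psi _ _ v3 v4 v1]cov_psi_cycle.
rewrite !psiO_orthogonal //; try by rewrite oformC.
have adj x y z : B x (y *o z) = B y (x *o oconj z) by rewrite oformC adjr.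
rewrite (adj v1) (adj v4) (adj v3) (adj v2) [v4 *o oconj v1]mul_conjC 1?oformC //.
rewrite [v3 *o oconj v2]mul_conjC 1?oformC //.
move: (v1 *o _) (v2 *o _) => x y; rewrite !oformE [B x y]oformC.
by ring.
Qed.

(** * Cayley-Dickson bases *)

Lemma im_conjl x c : c \in imO O -> B x c = 0 -> B (oconj x) c = 0.
Proof.
move=> cI xc; rewrite /oconj oformBl oformZl [B e1 c]oformC (im_form1 cI) xc mulr0.
exact: subr0.
Qed.

Lemma im_mulrr x c : c \in imO O -> (x *o c) *o c = - (onorm c *: x).
Proof.
move=> cI; apply: (scalerI two_neq0); have := conj_mulVr c c x.
rewrite (conj_im cI) omulNr omulNl -mulr2n -scaler_nat oform_onorm.
rewrite -scalerA scalerN => eqc.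
by rewrite scalerN -eqc opprK.
Qed.

Lemma oconj_doubling x c : c \in imO O -> B x c = 0 -> oconj (x *o c) = - (x *o c).
Proof.
by move=> cI xc; apply: conj_im; apply/mem_imP; rewrite im_skewr // omul1 xc oppr0.
Qed.

Lemma mul_doublingC x c : c \in imO O -> B x c = 0 -> x *o c = c *o oconj x.
Proof.
move=> cI xc; apply: oppr_inj.
by rewrite -(oconj_doubling cI xc) oconjM (conj_im cI) omulNl.
Qed.

(** This and the next two lemmas are the Cayley-Dickson multiplication rules, for
    x and y in a subalgebra that is doubled by an imaginary c orthogonal to it. *)
Lemma mul_doublingr x y c :
  c \in imO O -> B x c = 0 -> B y c = 0 -> B (y *o x) c = 0 ->
  x *o (y *o c) = (y *o x) *o c.
Proof.
move=> cI xc yc yxc; rewrite (mul_doublingC cI yc) (mul_doublingC cI yxc) oconjM.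
have := conj_mulVl (oconj x) c (oconj y).
rewrite oconjK (conj_im cI) omulNl im_conjl // mulr0 scale0r => /eqP.
by rewrite subr_eq0 => /eqP.
Qed.

Lemma mul_doublingl x y c : c \in imO O -> B y c = 0 ->
  (x *o c) *o y = (x *o oconj y) *o c.
Proof.
move=> cI yc; have := conj_mulVr y c x.
rewrite (conj_im cI) omulNr omulNl yc mulr0 scale0r => /eqP.
by rewrite subr_eq0 => /eqP.
Qed.

Lemma mul_doubling2 x y c : c \in imO O -> B x c = 0 -> B (y *o x) c = 0 ->
  (x *o c) *o (y *o c) = - (onorm c *: (oconj y *o x)).
Proof.
move=> cI xc yxc; have := conj_mulVl (oconj (x *o c)) y c.
rewrite oform_conjl adjr omul1 adjl -oconjM oformC im_conjl //.
rewrite mulr0 scale0r oconjK (oconj_doubling cI xc) omulNl omulNr => /eqP.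
rewrite subr_eq0 => /eqP ->.
by rewrite im_mulrr // omulNr omulZr.
Qed.

(** Addition in F_2^n. *)
Definition xorbits (i j : bitseq) : bitseq := [seq p.1 (+) p.2 | p <- zip i j].

(** The basis vector with index i of the algebra obtained from the scalars by
    successive doublings; the generator added last comes first in [gs]. *)
Fixpoint cdmon (gs : seq O) (i : bitseq) : O :=
  if gs is g :: gs' then
    if head false i then cdmon gs' (behead i) *o g else cdmon gs' (behead i)
  else e1.

(** The sign in the product of two basis vectors, read off from the four
    doubling rules.  Two of them exchange the factors, so the recursion is on
    the number of doublings. *)
Fixpoint cdsign (n : nat) (i j : bitseq) : bool :=
  if n is n'.+1 then
    let i' := behead i in let j' := behead j in
    match head false i, head false j with
    | false, false => cdsign n' i' j'
    | false, true => cdsign n' j' i'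
    | true, false => has id j' (+) cdsign n' i' j'
    | true, true => ~~ (has id j' (+) cdsign n' j' i')
    end
  else false.

(** The structure constant up to sign: a generator contributes its norm when it
    occurs in both factors. *)
Fixpoint cdcoef (gs : seq O) (i j : bitseq) : k :=
  if gs is g :: gs' then
    (if head false i && head false j then onorm g else 1) *
      cdcoef gs' (behead i) (behead j)
  else 1.

(** Each generator is orthogonal to the subalgebra that it doubles. *)
Fixpoint cd_orthogonal (gs : seq O) : Prop :=
  if gs is g :: gs' then
    [/\ g \in imO O,
        forall i, size i = size gs' -> B (cdmon gs' i) g = 0
      & cd_orthogonal gs']
  else True.

Lemma cdcoefC gs i j : cdcoef gs i j = cdcoef gs j i.
Proof. by elim: gs i j => //= g gs IH i j; rewrite IH andbC. Qed.

Lemma xorbitsC i j : xorbits i j = xorbits j i.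
Proof.
elim: i j => [|x i IH] [|y j] //=; rewrite /xorbits /= addbC.
by congr (_ :: _); apply: IH.
Qed.

Lemma size_xorbits i j : size i = size j -> size (xorbits i j) = size j.
Proof. by move=> ij; rewrite size_map size2_zip ?ij. Qed.

Lemma oconj_cdmon gs i : cd_orthogonal gs -> size i = size gs ->
  oconj (cdmon gs i) = (-1) ^+ has id i *: cdmon gs i.
Proof.
elim: gs i => [|g gs IH] [|z i] //=; first by rewrite conj1 scale1r.
move=> [gI og ogs] [si]; case: z => /=; last exact: IH.
by rewrite oconj_doubling ?og // scaleN1r.
Qed.

Lemma cdmon_mul gs i j :
  cd_orthogonal gs -> size i = size gs -> size j = size gs ->
  cdmon gs i *o cdmon gs j =
    ((-1) ^+ cdsign (size gs) i j * cdcoef gs i j) *: cdmon gs (xorbits i j).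
Proof.
elim: gs i j => [|g gs IH] [|z i] [|z' j] //=; first by rewrite omul1 mulr1 scale1r.
move=> [gI og ogs] [si] [sj].
have ogM : B (cdmon gs j *o cdmon gs i) g = 0.
  by rewrite IH // oformZl og ?mulr0 // size_xorbits // sj si.
case: z z' => [] [] /=; rewrite ?mul1r.
- rewrite mul_doubling2 ?og // oconj_cdmon // !omulE IH // xorbitsC cdcoefC.
  rewrite !scalerA -scaleNr; congr (_ *: _).
  by rewrite signrN signr_addb; ring.
- rewrite mul_doublingl ?og // oconj_cdmon // !omulE IH // omulZl scalerA.
  by congr (_ *: _); rewrite signr_addb; ring.
- by rewrite mul_doublingr ?og // IH // omulZl xorbitsC cdcoefC.
by rewrite IH.
Qed.

Lemma onorm_cdmon gs i : onorm (cdmon gs i) = cdcoef gs i i.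
Proof.
elim: gs i => [|g gs IH] i /=; first exact: onorm1.
by rewrite andbb; case: (head false i); rewrite ?onormM IH ?mul1r // mulrC.
Qed.

(** The value of 4 B(v1 conj v4, v2 conj v3) on basis vectors: conjugation
    contributes the signs [has id]. *)
Definition QO_value (gs : seq O) (i j l m : bitseq) : k :=
  let n := size gs in
  4%:R * (-1) ^+ (has id l (+) has id m (+) (cdsign n i m (+) cdsign n j l)) *
  (cdcoef gs i m * cdcoef gs j l * cdcoef gs (xorbits i m) (xorbits i m)).

Lemma QO_cdmon gs (i j l m : bitseq) : cd_orthogonal gs ->
  (forall i j, size i = size gs -> size j = size gs -> i != j ->
    B (cdmon gs i) (cdmon gs j) = 0) ->
  [/\ size i = size gs, size j = size gs, size l = size gs & size m = size gs] ->
  uniq [:: i; j; l; m] ->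
  cov_Q rho B muO (cdmon gs i) (cdmon gs j) (cdmon gs l) (cdmon gs m) =
    if xorbits i m == xorbits j l then QO_value gs i j l m else 0.
Proof.
move=> ogs og [si sj sl sm] /=.
rewrite !inE !negb_or => /and4P[/and3P[ij il im] /andP[jl jm] lm _].
rewrite QO_orthogonal ?og // !oconj_cdmon // !omulZr !cdmon_mul //.
rewrite !oformZl !oformZr.
case: eqP => [<-|/eqP xij]; last first.
  by rewrite og ?mulr0 // size_xorbits ?sm ?sl // sj.
by rewrite oform_onorm onorm_cdmon /QO_value /= !signr_addb; ring.
Qed.

(** * Expansion in the octonion basis *)

Section OctonionBasis.

Variables (e2 e3 e5 : O).
Hypotheses (e2I : e2 \in imO O) (e3I : e3 \in imO O) (e5I : e5 \in imO O).
Hypothesis ob : orthogonal_anisotropic_basis (oct_basis e2 e3 e5).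

Local Notation gens := [:: e5; e3; e2].
Local Notation e := (oct_basis e2 e3 e5).

(** The index in F_2^3 of the n-th vector of [oct_basis], n counted from 0; the
    leading bit is the exponent of [e5]. *)
Definition bits3 (n : nat) : bitseq := [:: odd n./2./2; odd n./2; odd n].

Lemma oct_basisE n : (n < 8)%N -> e`_n = cdmon gens (bits3 n).
Proof. by case: n => [|[|[|[|[|[|[|[|n]]]]]]]] //= _; rewrite omul1. Qed.

Lemma bits3P i : size i = 3 -> exists2 n, (n < 8)%N & i = bits3 n.
Proof.
case: i => [|x [|y [|z []]]] // _; exists (4 * x + 2 * y + z)%N.
  by case: x y z => [] [] [].
by case: x y z => [] [] [].
Qed.

Lemma oct_basis_orthogonal m n :
  (m < 8)%N -> (n < 8)%N -> m != n -> B e`_m e`_n = 0.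
Proof.
have [_ /(pairwiseP 0) ortho _] := ob.
move=> m8 n8; rewrite neq_ltn => /orP[mn|nm]; last rewrite oformC.
  by apply/eqP; apply: ortho.
by apply/eqP; apply: ortho.
Qed.

Lemma oct_basis_anisotropic n : (n < 8)%N -> onorm e`_n != 0.
Proof. by have [_ _ /(all_nthP 0) aniso] := ob => n8; apply: aniso. Qed.

Lemma cdmon_gens_orthogonal i j : size i = 3 -> size j = 3 -> i != j ->
  B (cdmon gens i) (cdmon gens j) = 0.
Proof.
move=> /bits3P[m m8 ->] /bits3P[n n8 ->] mn; rewrite -!oct_basisE //.
by apply: oct_basis_orthogonal => //; apply: contraNneq mn => ->.
Qed.

Lemma cd_orthogonal_gens : cd_orthogonal gens.
Proof.
have og := cdmon_gens_orthogonal.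
split=> //; last split=> //; last split=> //.
- move=> i si; rewrite -[e5]omul1.
  by apply: (og (false :: i) [:: true; false; false]); rewrite //= si.
- move=> i si; rewrite -[in X in B _ X](omul1 e3).
  by apply: (og (false :: false :: i) [:: false; true; false]); rewrite //= si.
move=> [] // _; rewrite -[in X in B _ X](omul1 e2).
exact: (og [:: false; false; false] [:: false; false; true]).
Qed.

Lemma oct_basis_dual x : x = \sum_(j < 8) (B x e`_j / onorm e`_j) *: e`_j.
Proof.
have [be _ _] := ob; have := coord_basis (X := in_tuple e) be (memvf x).
set c := coord _ => xE; rewrite {1}xE; apply: eq_bigr => /= j _; congr (_ *: _).
rewrite [in RHS]xE; have -> : B (\sum_i c i x *: (in_tuple e)`_i) e`_j =
   \sum_i c i x * B e`_i e`_j.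
  rewrite oformC linear_sum; apply: eq_bigr => i _ /=.
  by rewrite linearZ /= oformC.
rewrite (bigD1 j) //= big1 ?addr0 => [|i ij].
  by rewrite oform_onorm mulfK // oct_basis_anisotropic.
by rewrite oct_basis_orthogonal ?mulr0.
Qed.

Section EtaInverse.

Variables (L : vectType k) (wedge : 4.-tuple O -> L).
Variables (eta : 'Hom(L, 'Hom(L, k^o))) (QOlin : 'Hom(L, k^o)).
Hypothesis wedgeP : exterior_power wedge.
Hypothesis etaP : exterior_duality B wedge eta.
Hypothesis QOlinP : linear_form_of wedge (cov_Q rho B muO) QOlin.

(** In F_2^3, under [bits3], these are the 14 sets of four distinct points with
    sum 0. *)
Definition affine_planes : seq (seq nat) :=
  [:: [:: 0; 1; 2; 3]; [:: 0; 1; 6; 7]; [:: 0; 2; 5; 7]; [:: 0; 3; 5; 6];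
      [:: 0; 1; 4; 5]; [:: 0; 2; 4; 6]; [:: 0; 3; 4; 7]; [:: 1; 2; 4; 7];
      [:: 1; 2; 5; 6]; [:: 1; 3; 4; 6]; [:: 1; 3; 5; 7]; [:: 2; 3; 4; 5];
      [:: 2; 3; 6; 7]; [:: 4; 5; 6; 7]]%N.

Definition zero_sum (s : seq nat) : bool :=
  xorbits (bits3 (nth 0%N s 0)) (bits3 (nth 0%N s 3)) ==
    xorbits (bits3 (nth 0%N s 1)) (bits3 (nth 0%N s 2)).

Lemma affine_planesP a b c d : (a < 8)%N -> (b < 8)%N -> (c < 8)%N -> (d < 8)%N ->
  let s := [:: a; b; c; d] in sorted ltn s && zero_sum s = (s \in affine_planes).
Proof.
have all8 (p : pred nat) n : all p (index_iota 0 8) -> (n < 8)%N -> p n.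
  by move=> /allP ap n8; apply: ap; rewrite mem_index_iota.
have dec : all (fun a => all (fun b => all (fun c => all (fun d =>
    sorted ltn [:: a; b; c; d] && zero_sum [:: a; b; c; d] ==
      ([:: a; b; c; d] \in affine_planes))
  (index_iota 0 8)) (index_iota 0 8)) (index_iota 0 8)) (index_iota 0 8).
  by vm_compute.
move=> a8 b8 c8 d8; apply/eqP.
by move: dec => /all8/(_ a8)/all8/(_ b8)/all8/(_ c8)/all8/(_ d8).
Qed.

Local Notation entry s i := (e`_(nth 0%N s i)) (only parsing).
Local Notation W s :=
  (wedge [tuple entry s 0; entry s 1; entry s 2; entry s 3]).

Definition quad_term (s : seq nat) : L :=
  ((\prod_(i <- s) onorm e`_i)^-1 *
     cov_Q rho B muO (entry s 0) (entry s 1) (entry s 2) (entry s 3)) *: W s.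

Lemma bits3_inj : {in gtn 8 &, injective bits3}.
Proof.
pose f (i : bitseq) := (4 * nth false i 0 + 2 * nth false i 1 + nth false i 2)%N.
have fK : {in gtn 8, cancel bits3 f}.
  by case=> [|[|[|[|[|[|[|[|n]]]]]]]].
exact: can_in_inj fK.
Qed.

Lemma QO_sorted s : size s = 4 -> all (fun i => (i < 8)%N) s -> sorted ltn s ->
  let i := bits3 (nth 0%N s 0) in let j := bits3 (nth 0%N s 1) in
  let l := bits3 (nth 0%N s 2) in let m := bits3 (nth 0%N s 3) in
  cov_Q rho B muO (entry s 0) (entry s 1) (entry s 2) (entry s 3) =
    if zero_sum s then
      QO_value gens i j l m
    else 0.
Proof.
case: s => [|a [|b [|c [|d []]]]] // _ s8 /(sorted_uniq ltn_trans ltnn) su /=.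
have /= /and5P[a8 b8 c8 d8 _] := s8.
rewrite !oct_basisE // QO_cdmon //.
- exact: cd_orthogonal_gens.
- exact: cdmon_gens_orthogonal.
rewrite -[X in uniq X]/(map bits3 [:: a; b; c; d]) map_inj_in_uniq //.
by move=> x y /(allP s8) x8 /(allP s8) y8; apply: bits3_inj.
Qed.

Lemma eta_inv_QO : (eta^-1)%VF QOlin = \sum_(s <- affine_planes) quad_term s.
Proof.
have [altw _] := wedgeP.
have fact4 : 4`!%:R != 0 :> k.
  by rewrite (natrM k 8 3) mulf_neq0 ?eight_neq0 ?three_neq0.
rewrite (eta_invE wedgeP oct_basis_dual oformC etaP fact4 QOlin).
rewrite (big_tuple_sorted (k := k)); last 2 first.
- by move=> t tu; rewrite (alternating_uniq altw) // scaler0.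
- move=> t u /tuple_permP[s tE].
  have {tE} -> : t = tuple_perm u s by apply: val_inj.
  (* QOlin and wedge pick up the same sign, so the term is symmetric. *)
  rewrite tuple_perm_map (alternating_perm altw).
  have -> (g : k) (w : L) : QOlin (g *: w) = g * QOlin w by exact: linearZ.
  rewrite scalerA; congr (_ *: _).
  have -> : \prod_(i < 4) onorm e`_(tnth (tuple_perm u s) i) =
            \prod_(i < 4) onorm e`_(tnth u i).
    rewrite [RHS](reindex_inj (@perm_inj _ s)) /=.
    by apply: eq_bigr => i _; rewrite tnth_mktuple.
  by rewrite mulrCA mulrC signrMK.
rewrite scalerA mulVf // scale1r.
have GE (t : 4.-tuple 'I_8) :
  ((\prod_(i < 4) onorm e`_(tnth t i))^-1 *
     QOlin (wedge [tuple of [seq e`_(i : 'I_8) | i <- t]])) *: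
    wedge [tuple of [seq e`_(i : 'I_8) | i <- t]] = quad_term (map val t).
  have -> : [tuple of [seq e`_(i : 'I_8) | i <- t]] =
    let s := map val t in
    [tuple entry s 0; entry s 1; entry s 2; entry s 3].
    by apply: val_inj; case: t => -[|a [|b [|c [|d []]]]].
  by rewrite /quad_term /= QOlinP big_map big_tuple.
under eq_bigr do rewrite GE.
transitivity (\sum_(t : 4.-tuple 'I_8 |
    sorted ltn (map val t) && zero_sum (map val t)) quad_term (map val t)).
  rewrite [RHS]big_mkcondr; apply: eq_bigr => t st; case: ifP => // /negbT nz.
  rewrite /quad_term QO_sorted ?(negPf nz) ?mulr0 ?scale0r //.
  - by rewrite size_map size_tuple.
  - by apply/allP => _ /mapP[i _ ->]; apply: (ltn_ord i).
rewrite -big_filter -(big_map (fun t : 4.-tuple 'I_8 => map val t) xpredT quad_term).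
apply: perm_big; apply: uniq_perm => //.
  rewrite map_inj_uniq ?filter_uniq ?index_enum_uniq //.
  by move=> t u /(inj_map val_inj)/val_inj.
move=> s; apply/mapP/idP => [[t]|sF].
  rewrite mem_filter => /andP[tP _] ->.
  case: t tP => -[|a [|b [|c [|d []]]]] //= ? tP.
  by rewrite -affine_planesP ?ltn_ord.
have [s4 s8] : size s = 4 /\ all (fun i => (i < 8)%N) s.
  have dec : all (fun s => (size s == 4) && all (fun i => (i < 8)%N) s)
      affine_planes by [].
  by have /andP[/eqP] := allP dec s sF.
case: s s4 s8 sF => [|a [|b [|c [|d []]]]] // _ /and5P[a8 b8 c8 d8 _].
rewrite -affine_planesP // => sP.
exists [tuple Ordinal a8; Ordinal b8; Ordinal c8; Ordinal d8] => //.
by rewrite mem_filter mem_index_enum andbT.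
Qed.

Lemma quad_termE s (c : k) :
  [&& size s == 4, all (fun i => i < 8)%N s, sorted ltn s & zero_sum s] ->
  (let i := bits3 (nth 0%N s 0) in let j := bits3 (nth 0%N s 1) in
   let l := bits3 (nth 0%N s 2) in let m := bits3 (nth 0%N s 3) in
   QO_value gens i j l m) = c * \prod_(i <- s) onorm e`_i ->
  quad_term s = c *: W s.
Proof.
case/and4P=> /eqP s4 s8 ss sz cE; have := QO_sorted s4 s8 ss; rewrite sz => QE.
rewrite /quad_term (etrans QE cE) mulrC mulfK //.
rewrite prodf_seq_neq0; apply/allP => i /(allP s8) /= i8.
exact: oct_basis_anisotropic.
Qed.

End EtaInverse.

End OctonionBasis.

End Octonions.

(** * The covariants of the spin representation *)

Theorem proposition5p9 (k : fieldType)
    (char2 : 2%N \notin [pchar k]) (char3 : 3%N \notin [pchar k])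
    (O : octonionAlgebra k)
    (C : falgType k) (iota : {linear subvs_of (imO O) -> C})
    (C_clifford : clifford_algebra (@opp_norm_im k O) iota)
    (rho : {linear C -> 'End(O)}) (rho_ext : left_mul_extension iota rho)
    (muO : O -> O -> C) (muO_moment : moment_map_O iota rho muO)
    (muIm : O -> O -> C) (muIm_moment : moment_map_Im iota rho muIm) :
  let psiO := cov_psi rho muO in
  let QO := cov_Q rho (@oform k O) muO in
  let QIm := cov_Q rho (@oform k O) muIm in
  [/\
    (forall v1 v2 v3, v1 \in imO O -> v2 \in imO O -> v3 \in imO O ->
       psiO v1 v2 v3 = - (1 / 2%:R) *: associator v1 v2 v3 + phi v1 v2 v3 *: o1)
    /\ (forall v1 v2, v1 \in imO O -> v2 \in imO O ->
       psiO v1 v2 o1 = - cross v1 v2),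
    (forall v1 v2 v3 v4, v1 \in imO O -> v2 \in imO O -> v3 \in imO O ->
       v4 \in imO O ->
       QO v1 v2 v3 v4 = 2%:R / 3%:R * QIm v1 v2 v3 v4)
    /\ (forall v1 v2 v3, v1 \in imO O -> v2 \in imO O -> v3 \in imO O ->
       QO v1 v2 v3 o1 = - 4%:R * phi v1 v2 v3)
  & forall (L : vectType k) (wedge : 4.-tuple O -> L)
      (eta : 'Hom(L, 'Hom(L, k^o))) (QOlin : 'Hom(L, k^o)) (e2 e3 e5 : O),
      exterior_power wedge ->
      exterior_duality (@oform k O) wedge eta ->
      linear_form_of wedge QO QOlin ->
      e2 \in imO O -> e3 \in imO O -> e5 \in imO O ->
      orthogonal_anisotropic_basis (oct_basis e2 e3 e5) ->
      let e := wedge_basis wedge e2 e3 e5 in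
      let q2 := onorm e2 in let q3 := onorm e3 in let q5 := onorm e5 in
      (eta^-1)%VF QOlin =
          (4%:R / (q2 * q3)) *: e 1%N 2%N 3%N 4%N
        - (4%:R / (q2 * q3 * q5)) *: e 1%N 2%N 7%N 8%N
        + (4%:R / (q2 * q3 * q5)) *: e 1%N 3%N 6%N 8%N
        - (4%:R / (q2 * q3 * q5)) *: e 1%N 4%N 6%N 7%N
        + (4%:R / (q2 * q5)) *: e 1%N 2%N 5%N 6%N
        + (4%:R / (q3 * q5)) *: e 1%N 3%N 5%N 7%N
        + (4%:R / (q2 * q3 * q5)) *: e 1%N 4%N 5%N 8%N
        + (4%:R / (q2 * q3 * q5)) *: e 2%N 3%N 5%N 8%N
        - (4%:R / (q2 * q3 * q5)) *: e 2%N 3%N 6%N 7%N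
        - (4%:R / (q2 * q3 * q5)) *: e 2%N 4%N 5%N 7%N
        - (4%:R / (q2 ^+ 2 * q3 * q5)) *: e 2%N 4%N 6%N 8%N
        + (4%:R / (q2 * q3 * q5)) *: e 3%N 4%N 5%N 6%N
        - (4%:R / (q2 * q3 ^+ 2 * q5)) *: e 3%N 4%N 7%N 8%N
        - (4%:R / (q2 * q3 * q5 ^+ 2)) *: e 5%N 6%N 7%N 8%N].
Proof.
move=> psiO QO QIm; split.
- split=> [v1 v2 v3 I1 I2 I3|v1 v2 I1 I2].
    exact: (psiO_im char2 char3 rho_ext muO_moment).
  exact: (psiO_1 char2 char3 rho_ext muO_moment).
- split=> [v1 v2 v3 v4 I1 I2 I3 I4|v1 v2 v3 I1 I2 I3].
    exact: (QO_im char2 char3 rho_ext muO_moment muIm_moment).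
  exact: (QO_1 char2 char3 rho_ext muO_moment).
move=> L wedge eta QOlin e2 e3 e5 wedgeP etaP QOlinP e2I e3I e5I ob e q2 q3 q5.
have n2 : q2 != 0 := oct_basis_anisotropic ob (isT : (1 < 8)%N).
have n3 : q3 != 0 := oct_basis_anisotropic ob (isT : (2 < 8)%N).
have n5 : q5 != 0 := oct_basis_anisotropic ob (isT : (4 < 8)%N).
rewrite (eta_inv_QO char2 char3 rho_ext muO_moment e2I e3I e5I ob wedgeP etaP QOlinP).
rewrite /affine_planes !big_cons big_nil addr0 !addrA -!scaleNr.
(* On each plane the value of Q is 4 times a signed monomial in the norms of e2, e3, e5,
   to be compared with the product of the norms of the four vectors. *)
do 13?[congr (_ + _)];
  apply: (quad_termE char2 char3 rho_ext muO_moment e2I e3I e5I ob) => //;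
  rewrite /QO_value /= !big_cons big_nil /= !onormM ?onorm1 -/q2 -/q3 -/q5;
  by field; rewrite ?n2 ?n3 ?n5.
Qed.
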